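(* Let $\Delta=[a,b]$ with $a,b\in\mathbb{R}$, $0<a<b$. Assume: (1) for all $t\in\mathbb{Z}$, the conditional density $f^{\mathcal{F}_{t-1}}$ of $X_t$ given $\mathcal{F}_{t-1}$ exists, $f^{\mathcal{F}_{t-1}}\in C_0(\mathbb{R})$, and $f\in C_0(\mathbb{R})$; (2) $\left\|\frac1n\sum_{t=1}^n f^{\mathcal{F}_{t-1}}-f\right\|_0\to 0$ almost surely as $n\to+\infty$; (3) $R$ is a continuous and bounded function on $[0,+\infty[$; (4) $E(\Phi(Y_t)\mid\mathcal{G}_{t-1})=E(\Phi(Y_t)\mid X_t)=R(X_t)$ for all $t\in\mathbb{Z}$; (5) $E\left(|\Phi(Y_1)|^{\tau+1}\right)<+\infty$ for some $\tau>0$; (6) $\inf_{x\in\Delta}f(x)>0$; (7) the sequence $n\sqrt{h_n}$ increases to $+\infty$, and there exists $\theta\in\left]0,\frac{\tau}{\tau+1}\right[$ such that $\lim_{n\to+\infty}\frac{n^{\theta}h_n}{\log n}=+\infty$. Then $$\sup_{x\in\Delta}\left|R_n(x)-R(x)\right|\to 0\quad\text{almost surely as } n\to+\infty.$$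
   Context: $\{(X_t,Y_t),\,t\in\mathbb{Z}\}$ is a strictly stationary and ergodic $[0,+\infty[^2$-valued stochastic process on a probability space $(\Omega,\mathcal{A},P)$, with absolutely continuous marginal distributions; $f$ is the density of $X_t$. $\Phi:[0,+\infty[\to\mathbb{R}$ is a known measurable function with $E(|\Phi(Y_1)|)<+\infty$, and $R(x)=E(\Phi(Y_1)\mid X_1=x)$ is the regression function (for $x\ge0$ with $f(x)>0$). For $t\in\mathbb{Z}$, $\mathcal{F}_t=\sigma\{(X_s,Y_s),\,s\le t\}$ and $\mathcal{G}_t=\sigma\{X_{t+1},(X_s,Y_s),\,s\le t\}$. $C_0(\mathbb{R})$ is the space of continuous functions on $\mathbb{R}$ tending to zero at infinity, with the sup-norm $\|\cdot\|_0$. The bandwidth sequence $(h_n)_{n\in\mathbb{N}}$ consists of positive reals with $\lim_{n\to+\infty}h_n=0$. For $x\ge 0$, $K_{\alpha(n,x),\beta(n)}$ is the density of the gamma distribution with shape $\alpha(n,x)=\frac{x}{h_n}+1$ and scale $\beta(n)=h_n$: $$K_{\alpha(n,x),\beta(n)}(y)=\frac{1}{\Gamma(\alpha(n,x))\,\beta(n)^{\alpha(n,x)}}\,y^{\alpha(n,x)-1}e^{-y/\beta(n)}\,\mathbb{1}_{[0,+\infty[}(y),\quad y\in\mathbb{R}.$$ The gamma kernel regression estimator is $$R_n(x)=\frac{\sum_{t=1}^n\Phi(Y_t)K_{\alpha(n,x),\beta(n)}(X_t)}{\sum_{t=1}^nK_{\alpha(n,x),\beta(n)}(X_t)},$$ with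 the convention $\frac{y}{0}=0$ for all $y\in\mathbb{R}$. *)

(* Defs.v *)
From HB Require Import structures.
From mathcomp Require Export all_boot all_order all_algebra.
From mathcomp Require Export all_classical all_reals all_analysis.
From mathcomp Require Export measurable_realfun.
Export Order.TTheory GRing.Theory Num.Theory.
Export numFieldNormedType.Exports.

Set Implicit Arguments.
Unset Strict Implicit.
Unset Printing Implicit Defensive.

Local Open Scope classical_set_scope.
Local Open Scope ring_scope.

Section processes.
Context d (T : measurableType d) (R : realType) (P : probability T R).
Context d' (S : measurableType d').

(* Product sigma-algebra on the path space. *)
Definition path_sigma_algebra : set (set (int -> S)) :=
  <<s \bigcup_(t in [set: int])
        preimage_set_system setT (fun u : int -> S => u t) measurable >>.

Definition strictly_stationary (Z : int -> T -> S) : Prop :=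
  forall (s : int) (B : set (int -> S)), path_sigma_algebra B ->
    P [set w | B (fun t => Z (t + s) w)] = P [set w | B (fun t => Z t w)].

Definition ergodic (Z : int -> T -> S) : Prop :=
  forall B : set (int -> S), path_sigma_algebra B ->
    [set u | B (fun t => u (t + 1))] = B ->
    P [set w | B (fun t => Z t w)] = 0%E \/
    P [set w | B (fun t => Z t w)] = 1%E.

End processes.

Section conditioning.
Context d (T : measurableType d) (R : realType) (P : probability T R).

(* V is a version of E(U | G); G is meant to be a sub-sigma-algebra, for which
   g_sigma_algebraType G is T with G as its measurable sets. *)
Definition is_cond_exp (G : set (set T)) (U V : T -> \bar R) : Prop :=
  [/\ P.-integrable setT U,
      measurable_fun setT (V : g_sigma_algebraType G -> \bar R),
      P.-integrable setT V &
      forall B, G B ->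
        (\int[P]_(w in B) V w = \int[P]_(w in B) U w)%E].

(* g w x is the value at x of the density, with respect to the Lebesgue
   measure, of the conditional distribution of X given G at the outcome w. *)
Definition is_cond_density (G : set (set T)) (X : T -> R) (g : T -> R -> R) :
  Prop :=
  [/\ forall w x, 0 <= g w x,
      measurable_fun setT (fun p : g_sigma_algebraType G * R => g p.1 p.2) &
      forall A : set R, measurable A ->
        is_cond_exp G (fun w => (\1_A (X w))%:E)
          (fun w => \int[lebesgue_measure]_(x in A) (g w x)%:E)%E].

Definition is_density (X : {RV P >-> R}) (f : R -> R) : Prop :=
  [/\ forall x, 0 <= f x,
      measurable_fun setT f &
      forall A : set R, measurable A ->
        (distribution P X A = \int[lebesgue_measure]_(x in A) (f x)%:E)%E].

(* r(x) = E(U | X = x) for a nonnegative random variable X: the values of r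
   are only determined up to a null set of the distribution of X. *)
Definition is_regression (U : T -> R) (X : T -> R) (r : R -> R) : Prop :=
  measurable_fun (`[0, +oo[ : set R) r /\
  is_cond_exp (preimage_set_system setT X measurable)
    (EFin \o U) (EFin \o r \o X).

Definition past (X Y : int -> T -> R) (t : int) : set (set T) :=
  <<s \bigcup_(s in [set s : int | (s <= t)%R])
        preimage_set_system setT (fun w => (X s w, Y s w)) measurable >>.

Definition past_next (X Y : int -> T -> R) (t : int) : set (set T) :=
  <<s preimage_set_system setT (X (t + 1)) measurable `|`
      \bigcup_(s in [set s : int | (s <= t)%R])
        preimage_set_system setT (fun w => (X s w, Y s w)) measurable >>.

End conditioning.

Section functions_on_the_line.
Context (R : realType).

Definition C0 (g : R -> R) : Prop :=
  [/\ continuous g, g x @[x --> +oo] --> (0 : R) &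
      g x @[x --> -oo] --> (0 : R)].

(* Supremum of |g| on D, equal to +oo if g is unbounded on D. *)
Definition sup_abs (D : set R) (g : R -> R) : \bar R :=
  ereal_sup [set `|g x|%:E | x in D].

Definition Gamma (a : R) : R :=
  \int[lebesgue_measure]_(t in `]0, +oo[) (t `^ (a - 1) * expR (- t)).

(* Since 0 `^ 0 = 1, the density with shape 1 is 1 / scale at the origin. *)
Definition gamma_density (shape scale y : R) : R :=
  (Gamma shape * scale `^ shape)^-1 * y `^ (shape - 1) *
  expR (- (y / scale)) * \1_`[0, +oo[ y.

Definition gamma_kernel (h : nat -> R) (n : nat) (x y : R) : R :=
  gamma_density (x / h n + 1) (h n) y.

(* The convention y / 0 = 0 is the one of division in MathComp fields. *)
Definition gamma_regression_estimator (T : Type) (h : nat -> R) (Phi : R -> R)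
    (X Y : int -> T -> R) (n : nat) (w : T) (x : R) : R :=
  (\sum_(1 <= t < n.+1) Phi (Y t%:Z w) * gamma_kernel h n x (X t%:Z w)) /
  (\sum_(1 <= t < n.+1) gamma_kernel h n x (X t%:Z w)).

End functions_on_the_line.

(* Main.v *)
From HB Require Import structures.
Require Import Defs.
From mathcomp Require Import all_boot all_order all_algebra.
From mathcomp Require Import all_classical all_reals all_analysis.
From mathcomp Require Import measurable_realfun.
From mathcomp Require Import ring lra zify.

(* The estimator is a quotient, so the gamma kernel may be divided by its
   maximum: the normalized kernel k_x takes values in [0, 1], equals 1 at x, is
   bounded below on the window of radius sqrt h_n around x, is exponentially
   small away from x, and is Lipschitz in x with constant of order 1 / h_n.  With
   xi_t = Phi(Y_t) - R(X_t), the error R_n(x) - R(x) is the quotient of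
   sum_t xi_t k_x(X_t) + sum_t (R(X_t) - R(x)) k_x(X_t) by sum_t k_x(X_t).
   The denominator dominates the number of visits of X to a window of width
   sqrt h_n / 2, which is at least c n sqrt h_n because the averaged conditional
   densities converge uniformly to f.  The second sum is small compared with the
   denominator because R is uniformly continuous near [a, b].  For the first sum,
   truncate Phi(Y_t) at M = n^((1 - theta) / 2).  The truncated sums are
   controlled, on a grid of n^4 points x, by exponential supermartingales
   compensated by 2 M^(- tau) E(|Phi(Y_t)|^(tau + 1) | G_(t-1)); the tails and
   the compensators are controlled by the (tau + 1)-th moment.  All almost sure
   bounds follow from Tonelli's theorem: nonnegative variables with uniformly
   bounded means have partial sums of order n^(1 + eps) for every eps > 0. *)

Set Implicit Arguments.
Unset Strict Implicit.
Unset Printing Implicit Defensive.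

Import Order.TTheory GRing.Theory Num.Theory.

Local Open Scope classical_set_scope.
Local Open Scope ring_scope.

(** * The normalized gamma kernel *)

(** No mixing rate is assumed, so every sum is compared with conditional expectations along the
    filtration. The conditional moment E(|Phi(Y_t)|^(tau + 1) | G_(t-1)) is random and need not be
    bounded, so the bias created by truncation has no deterministic bound. It is subtracted inside
    the exponential as a predictable compensator, and only its sum over t is estimated afterwards.
    The truncation level balances two errors against the denominator, whose order is at least n sqrt
    h_n. With M = n^((1 - theta) / 2) the deviation M sqrt(n log n) has square n^(2 - theta) log n,
    which is negligible against n^2 h_n exactly when n^theta h_n / log n tends to infinity. Tails
    and compensators are of order M^(- tau) n^(1 + eps); for eps = (tau (1 - theta) - theta) / 2 the
    square is n^(2 - theta), and this eps is positive exactly when theta < tau / (tau + 1). *)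

Section log_deviation.
Context (R : realType).
Implicit Types v eta : R.

(** The Cramer rate function of the standard exponential law; the normalized kernel is the
    exponential of [- (x / h)] times its value at [y / x]. *)
Definition log_dev v : R := v - 1 - ln v.

Lemma ln_leB1 v : 0 < v -> ln v <= v - 1.
Proof.
by move=> v0; have := @le_ln1Dx _ (v - 1); rewrite (addrC 1) subrK; apply; lra.
Qed.

Lemma ln_le_sqrt v : 0 < v -> ln v <= 2 * (Num.sqrt v - 1).
Proof.
move=> v0; have s0 : 0 < Num.sqrt v by rewrite sqrtr_gt0.
rewrite -{1}(sqr_sqrtr (ltW v0)) lnXn// mulr2n.
by have := ln_leB1 s0; lra.
Qed.

(** Applying the tangent inequality to [ln v = 2 * ln (Num.sqrt v)] leaves
    [v - 1 - 2 * (Num.sqrt v - 1)], a perfect square. *)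
Lemma log_dev_ge_sqr v : 0 < v -> (Num.sqrt v - 1) ^+ 2 <= log_dev v.
Proof.
move=> v0; have := ln_le_sqrt v0; rewrite /log_dev.
by have := sqr_sqrtr (ltW v0); nra.
Qed.

Lemma log_dev_ge0 v : 0 < v -> 0 <= log_dev v.
Proof. by move=> v0; exact: le_trans (sqr_ge0 _) (log_dev_ge_sqr v0). Qed.

(** With [s = Num.sqrt v], [|v - 1| = |s - 1| * (s + 1)]: the last factor is at most 3 when
    [s <= 2], and otherwise [|s - 1|] already exceeds 1. The 9 is the square of this 3. *)
Lemma log_dev_far eta v : 0 < v -> 0 <= eta <= 1 -> eta <= `|v - 1| ->
  eta ^+ 2 / 9 <= log_dev v.
Proof.
move=> v0 /andP[e0 e1] ev; apply: le_trans (log_dev_ge_sqr v0).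
have s0 : 0 < Num.sqrt v by rewrite sqrtr_gt0.
have sv := sqr_sqrtr (ltW v0); set s := Num.sqrt v in s0 sv *.
suff : eta / 3 <= `|s - 1|.
  move=> H; rewrite -(real_normK (num_real (s - 1))).
  have : (eta / 3) ^+ 2 <= `|s - 1| ^+ 2 by rewrite ler_sqr ?nnegrE//; lra.
  by apply: le_trans; lra.
move: ev; have [v1|v1] := leP 1 v.
- have s1 : 1 <= s by nra.
  rewrite !ger0_norm; [|lra|lra] => ev.
  have [s2|s2] := leP s 2; nra.
- have s1 : s < 1 by nra.
  rewrite !ltr0_norm; [|lra|lra] => ev; nra.
Qed.

Lemma log_dev_near v : 0 < v -> log_dev v <= (v - 1) ^+ 2 / v.
Proof.
move=> v0; have vV0 : 0 < v^-1 by rewrite invr_gt0.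
have := ln_leB1 vV0; rewrite lnV ?posrE// /log_dev => H.
have -> : (v - 1) ^+ 2 / v = v - 2 + v^-1 by field; rewrite gt_eqF.
lra.
Qed.

Lemma norm_ln_le_log_dev v : 0 < v -> `|ln v| <= log_dev v + 1.
Proof.
move=> v0; rewrite /log_dev; have := ln_leB1 v0; have := ln_le_sqrt v0.
have sv := sqr_sqrtr (ltW v0); have s0 : 0 <= Num.sqrt v by [].
have := sqr_ge0 (Num.sqrt v - 2); rewrite sqrrB sv => H0 H1 H2.
by rewrite ler_norml; apply/andP; split; lra.
Qed.

End log_deviation.

Section normalized_kernel.
Context (R : realType).
Implicit Types h x y : R.

(* The gamma kernel divided by its maximum, reached at [y = x]: the estimator
   is a quotient, so this normalization does not change it. *)
Definition nkernel h x y : R :=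
  y `^ (x / h) * expR (- (y / h)) / (x `^ (x / h) * expR (- (x / h))).

Lemma nkernelE h x y : 0 < h -> 0 < x -> 0 < y ->
  nkernel h x y = expR (- (x / h) * log_dev (y / x)).
Proof.
move=> h0 x0 y0; rewrite /nkernel /powR !gt_eqF// -!expRD -expRN -expRD.
congr expR; rewrite /log_dev ln_div//.
by field; rewrite !gt_eqF.
Qed.

Lemma nkernel0 h x : 0 < h -> 0 < x -> nkernel h x 0 = 0.
Proof.
move=> h0 x0; rewrite /nkernel powR0 ?mul0r// gt_eqF//.
by rewrite divr_gt0.
Qed.

Lemma nkernel_ge0 h x y : 0 <= nkernel h x y.
Proof. by rewrite /nkernel divr_ge0// mulr_ge0// ?powR_ge0// expR_ge0. Qed.

Lemma nkernel_le1 h x y : 0 < h -> 0 < x -> 0 <= y -> nkernel h x y <= 1.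
Proof.
move=> h0 x0; rewrite le_eqVlt => /predU1P[<-|y0]; first by rewrite nkernel0.
rewrite nkernelE// expR_le1 mulNr oppr_le0 mulr_ge0 ?log_dev_ge0//.
  by rewrite divr_ge0 ?ltW.
by rewrite divr_gt0.
Qed.

Lemma measurable_nkernel h x : measurable_fun setT (nkernel h x).
Proof.
apply: measurable_funM => //; apply: measurable_funM.
  exact: measurable_powR.
apply: measurableT_comp => //; apply: measurableT_comp => //.
exact: measurable_funM.
Qed.

(** The exponent is at most [(y - x) ^+ 2 / (h * y) <= 1 / y], and [y >= a / 2] on the window. *)
Lemma nkernel_near h a x y : 0 < a -> a <= x -> 0 < h ->
  Num.sqrt h <= a / 2 -> `|y - x| <= Num.sqrt h -> expR (- (2 / a)) <= nkernel h x y.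
Proof.
move=> a0 ax h0 ha yx.
have sh := sqr_sqrtr (ltW h0); set s := Num.sqrt h in sh yx ha *.
have x0 : 0 < x by lra.
have [yx1 yx2] : - s <= y - x /\ y - x <= s by move: yx; rewrite ler_norml => /andP.
have y0 : 0 < y by lra.
rewrite nkernelE// ler_expR mulNr lerN2.
have v0 : 0 < y / x by rewrite divr_gt0.
apply: (@le_trans _ _ (x / h * ((y / x - 1) ^+ 2 / (y / x)))).
  by rewrite ler_wpM2l ?log_dev_near// divr_ge0 ?ltW.
have -> : x / h * ((y / x - 1) ^+ 2 / (y / x)) = (y - x) ^+ 2 / (h * y).
  by field; rewrite !gt_eqF.
rewrite ler_pdivrMr ?mulr_gt0//.
apply: (@le_trans _ _ h); first by rewrite -sh; nra.
have -> : 2 / a * (h * y) = h * (2 * y / a) by field; rewrite gt_eqF.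
rewrite ler_pMr// ler_pdivlMr//; lra.
Qed.

(** As [x <= b], the relative deviation of [y] from [x] is at least [delta / b]; [delta <= b] keeps
    this ratio in the range where the quadratic lower bound on [log_dev] is valid. *)
Lemma nkernel_far h a b delta x y : 0 < a -> a <= x -> x <= b -> 0 < h ->
  0 <= delta <= b -> 0 <= y -> delta <= `|y - x| ->
  nkernel h x y <= expR (- (a / h * ((delta / b) ^+ 2 / 9))).
Proof.
move=> a0 ax xb h0 /andP[d0 db]; rewrite le_eqVlt => /predU1P[<-|y0] dyx.
  by rewrite nkernel0 ?expR_ge0//; lra.
have x0 : 0 < x by lra. have b0 : 0 < b by lra.
rewrite nkernelE// ler_expR mulNr lerN2.
apply: ler_pM.
- by rewrite divr_ge0 ?ltW.
- by rewrite divr_ge0// sqr_ge0.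
- by rewrite ler_wpM2r// invr_ge0 ltW.
apply: log_dev_far; first by rewrite divr_gt0.
  apply/andP; split; first by rewrite divr_ge0// ltW.
  by rewrite ler_pdivrMr ?mul1r.
have -> : y / x - 1 = (y - x) / x by field; rewrite gt_eqF.
rewrite normf_div (gtr0_norm x0).
by rewrite ler_pM ?invr_ge0 ?(ltW b0)// lef_pV2.
Qed.

(** Lets a kernel value absorb the logarithmic factor of its derivative in [x], which is unbounded
    in [y]. *)
Lemma mulr_expRN_le (s p : R) : 0 < s -> 0 <= p -> expR (- s * p) * (p + 1) <= s^-1 + 1.
Proof.
move=> s0 p0; rewrite mulNr expRN ler_pdivrMl ?expR_gt0//.
have := expR_ge1Dx (s * p) => H.
apply: (@le_trans _ _ ((1 + s * p) * (s^-1 + 1))); last first.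
  by rewrite ler_wpM2r// addr_ge0// invr_ge0 ltW.
have -> : (1 + s * p) * (s^-1 + 1) = p + 1 + (s^-1 + s * p) by field; rewrite gt_eqF.
by rewrite lerDl addr_ge0 ?invr_ge0 ?(ltW s0)// mulr_ge0// ltW.
Qed.

Lemma expRB_le (p q : R) : expR p - expR q <= expR p * (p - q).
Proof.
have -> : q = p + (q - p) by lra.
rewrite expRD; have := expR_ge1Dx (q - p); have := expR_gt0 p; nra.
Qed.

(** The logarithm of the kernel has derivative [(ln y - ln x) / h] in [x], unbounded as [y]
    approaches 0 or infinity. Convexity of the exponential puts the kernel value [K] at [x] in front
    of the difference of exponents; since [|ln y - ln x'|] is bounded by [log_dev (y / x)] plus
    constants, [K] compensates it. *)
Lemma nkernel_lipschitz_onesided h a b x x' y : 0 < a -> 0 < h ->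
  a <= x <= b -> a <= x' <= b -> 0 <= y ->
  nkernel h x y - nkernel h x' y <= `|x - x'| / h * (h / a + 1 + ln (b / a)).
Proof.
move=> a0 h0 /andP[ax xb] /andP[ax' xb']; rewrite le_eqVlt => /predU1P[<-|y0].
  rewrite !nkernel0 ?subrr; [|lra..].
  rewrite mulr_ge0// ?divr_ge0 ?(ltW h0)// !addr_ge0 ?divr_ge0 ?(ltW h0) ?(ltW a0)//.
  by rewrite ln_ge0// ler_pdivlMr// mul1r; lra.
have x0 : 0 < x by lra. have x'0 : 0 < x' by lra.
rewrite !nkernelE//; apply: le_trans (expRB_le _ _) _.
set K := expR _.
have K0 : 0 < K by rewrite expR_gt0.
have K1 : K <= 1.
  rewrite expR_le1 mulNr oppr_le0 mulr_ge0 ?log_dev_ge0 ?divr_gt0//.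
  by rewrite divr_ge0 ?ltW.
have -> : - (x / h) * log_dev (y / x) - - (x' / h) * log_dev (y / x') =
    h^-1 * ((x - x') * (ln y - ln x') + x * (ln x' - ln x) + (x - x')).
  by rewrite /log_dev !ln_div//; field; rewrite !gt_eqF.
(* Makes the last two terms of the difference of exponents nonpositive together. *)
have H1 : x * (ln x' - ln x) <= x' - x.
  rewrite -ln_div//; have := ln_leB1 (divr_gt0 x'0 x0).
  rewrite -(ler_pM2l x0); congr (_ <= _).
  by field; rewrite gt_eqF.
have H2 : `|ln y - ln x'| <= (log_dev (y / x) + 1) + ln (b / a).
  have -> : ln y - ln x' = ln (y / x) + (ln x - ln x') by rewrite ln_div//; lra.
  apply: le_trans (ler_normD _ _) _; rewrite lerD//.
    by rewrite norm_ln_le_log_dev// divr_gt0.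
  rewrite ler_norml ln_div ?posrE//; last lra.
  have b0 : 0 < b by lra.
  have := ax; rewrite -ler_ln ?posrE// => l1.
  have := ax'; rewrite -ler_ln ?posrE// => l2.
  have := xb; rewrite -ler_ln ?posrE// => l3.
  have := xb'; rewrite -ler_ln ?posrE// => l4.
  by apply/andP; split; lra.
apply: (@le_trans _ _ (K * (h^-1 * (`|x - x'| * `|ln y - ln x'|)))).
  rewrite ler_wpM2l ?(ltW K0)// ler_wpM2l ?invr_ge0 ?(ltW h0)//.
  by rewrite -normrM; have := ler_norm ((x - x') * (ln y - ln x')); lra.
have -> : K * (h^-1 * (`|x - x'| * `|ln y - ln x'|)) =
  `|x - x'| / h * (K * `|ln y - ln x'|) by ring.
rewrite ler_wpM2l ?divr_ge0 ?(ltW h0)//.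
apply: (@le_trans _ _ (K * (log_dev (y / x) + 1) + K * ln (b / a))).
  by rewrite -mulrDr ler_wpM2l// ltW.
rewrite lerD//; last first.
  rewrite ler_piMl// ln_ge0// ler_pdivlMr ?mul1r//; lra.
apply: (@le_trans _ _ ((x / h)^-1 + 1)).
  by apply: mulr_expRN_le; rewrite ?log_dev_ge0 ?divr_gt0.
rewrite lerD2r invfM invrK mulrC ler_wpM2l ?(ltW h0)// lef_pV2//.
Qed.

Lemma nkernel_lipschitz h a b x x' y : 0 < a -> 0 < h ->
  a <= x <= b -> a <= x' <= b -> 0 <= y ->
  `|nkernel h x y - nkernel h x' y| <= `|x - x'| / h * (h / a + 1 + ln (b / a)).
Proof.
move=> a0 h0 xab x'ab y0; rewrite ler_norml nkernel_lipschitz_onesided// andbT.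
by rewrite lerNl opprB distrC nkernel_lipschitz_onesided.
Qed.

End normalized_kernel.

(** * Conditional expectations given a sub-sigma-algebra *)

Section sub_sigma_algebra.
Context d (T : measurableType d) (R : realType) (P : probability T R).
Variable G : set (set T).
Hypothesis sG : sigma_algebra setT G.
Hypothesis subG : G `<=` measurable.

Local Notation TG := (g_sigma_algebraType G).

Lemma measurable_subE : (@measurable _ TG) = G.
Proof. exact: sigma_algebra_id. Qed.

Lemma measurable_fun_sub d' (S : measurableType d') (g : T -> S) :
  measurable_fun setT (g : TG -> S) -> measurable_fun setT g.
Proof.
move=> mg _ B mB; apply: subG; rewrite -measurable_subE.
exact: mg.
Qed.

Import HBNNSimple.

(** Both sides are limits of integrals against simple [G]-measurable weights increasing to [W]; for
    these the claim is a finite combination of the hypothesis on level sets, which lie in [G]. *)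
Lemma ge0_integral_weight (U1 U2 : T -> \bar R) (W : T -> R) :
  measurable_fun setT U1 -> measurable_fun setT U2 ->
  (forall w, (0 <= U1 w)%E) -> (forall w, (0 <= U2 w)%E) ->
  (forall B, G B -> (\int[P]_(w in B) U1 w = \int[P]_(w in B) U2 w)%E) ->
  measurable_fun setT (W : TG -> R) -> (forall w, 0 <= W w) ->
  (\int[P]_w ((W w)%:E * U1 w) = \int[P]_w ((W w)%:E * U2 w))%E.
Proof.
move=> mU1 mU2 U10 U20 U12 mW W0.
have mEW : measurable_fun setT (EFin \o (W : TG -> R)).
  by apply/measurable_EFinP.
pose h := nnsfun_approx (@measurableT _ TG) mEW.
have mh n : measurable_fun setT (h n : T -> R).
  exact/measurable_fun_sub/measurable_funP.
have W0' w : setT w -> (0 <= (EFin \o (W : TG -> R)) w)%E by rewrite /= lee_fin.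
have limE (U : T -> \bar R) : measurable_fun setT U -> (forall w, (0 <= U w)%E) ->
    (\int[P]_w ((W w)%:E * U w) =
     lim (\int[P]_w ((h n w)%:E * U w) @[n --> \oo]))%E.
  move=> mU U0.
  have hU w : ((W w)%:E * U w = lim ((h n w)%:E * U w @[n --> \oo]))%E.
    have cvgh : (EFin \o h ^~ w) @ \oo --> ((W w)%:E : \bar R).
      exact: (@cvg_nnsfun_approx _ TG _ _ _ _ mEW W0' w).
    have [->|Uw0] := eqVneq (U w) 0%E.
      by rewrite mule0; under eq_fun do rewrite mule0; rewrite lim_cst.
    apply/esym/cvg_lim => //.
    have [Ufin|] := boolP (U w \is a fin_num); first exact: cvgeZr.
    (* Multiplication by [+oo] is not continuous at 0: the products are constantly 0 if [W w] is 0,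
       and eventually [+oo] otherwise. *)
    rewrite ge0_fin_numE// -leNgt leye_eq => /eqP Uy; rewrite Uy.
    have := W0 w; rewrite le_eqVlt => /predU1P[W00|Wgt0].
      have h0 n : h n w = 0.
        apply/eqP; rewrite eq_le fun_ge0 andbT -lee_fin W00.
        by rewrite /h nnsfun_approxE; exact: (le_approx n W0' I).
      by rewrite -W00 mul0e; under eq_fun do rewrite h0 mul0e; exact: cvg_cst.
    rewrite gt0_muley ?lte_fin//; apply: cvg_near_cst.
    have : \forall n \near \oo, 0 < h n w.
      move/fine_cvgP : cvgh => [_ /=] /cvgr_gt; exact.
    by apply: filterS => n hn; rewrite gt0_muley ?lte_fin.
  under eq_integral do rewrite hU.
  apply: monotone_convergence => //.
  - by move=> n; apply: emeasurable_funM => //; exact/measurable_EFinP.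
  - by move=> n w _; rewrite mule_ge0// lee_fin.
  - move=> w _ m n mn; rewrite lee_wpmul2r// lee_fin.
    by have /lefP/(_ w) := nd_nnsfun_approx (@measurableT _ TG) mEW mn.
rewrite !limE//.
suff U12h n : (\int[P]_w ((h n w)%:E * U1 w) = \int[P]_w ((h n w)%:E * U2 w))%E.
  by under eq_fun do rewrite U12h.
have sumE (U : T -> \bar R) : measurable_fun setT U -> (forall w, (0 <= U w)%E) ->
    (\int[P]_w ((h n w)%:E * U w) =
     \sum_(y \in range (h n)) (y%:E * \int[P]_(w in h n @^-1` [set y]) U w))%E.
  move=> mU U0.
  have mI y : measurable (h n @^-1` [set y] : set T).
    by have := mh n measurableT [set y] (measurable_set1 y); rewrite setTI.
  transitivity (\int[P]_w (\sum_(y \in range (h n))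
      ((y * \1_(h n @^-1` [set y]) w)%:E * U w)))%E.
    apply: eq_integral => w _.
    rewrite -ge0_mule_fsuml => [|y]; last exact: nnfun_muleindic_ge0.
    rewrite fsumEFin//; congr (_%:E * _)%E.
    exact: (@fimfunE TG _ (h n) w).
  rewrite ge0_integral_fsum//; last 2 first.
  - move=> y; apply: emeasurable_funM => //; apply/measurable_EFinP.
    exact: measurable_funM.
  - by move=> y w _; rewrite mule_ge0// nnfun_muleindic_ge0.
  apply: eq_fsbigr => y; rewrite inE => -[t _ <-].
  under eq_integral do rewrite EFinM -muleA.
  rewrite ge0_integralZl//; last 3 first.
  - apply: emeasurable_funM => //; exact/measurable_EFinP.
  - by move=> w _; rewrite mule_ge0// lee_fin.
  - by rewrite lee_fin.
  congr (_ * _)%E; rewrite [RHS]integral_mkcond; apply: eq_integral => w _.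
  by rewrite epatch_indic muleC.
rewrite !sumE//; apply: eq_fsbigr => y _; congr (_ * _)%E; apply: U12.
suff : (@measurable _ TG) (h n @^-1` [set y]) by rewrite measurable_subE.
by rewrite -[X in measurable X]setTI; exact: (measurable_funP (h n)).
Qed.

(** Radon-Nikodym on the coarser measurable space: the measure [B |-> \int_B Z] has a density with
    respect to the restriction of [P] to [G], obtained as the pushforward of [P] under the
    identity. *)
Lemma cond_exp_exists (Z : T -> R) :
  P.-integrable setT (EFin \o Z) -> (forall w, 0 <= Z w) ->
  exists V : T -> R,
  [/\ measurable_fun setT (V : TG -> R), forall w, 0 <= V w &
    forall B, G B -> (\int[P]_(w in B) (V w)%:E = \int[P]_(w in B) (Z w)%:E)%E].
Proof.
move=> iZ Z0.
have mG (B : set TG) : measurable B -> measurable (B : set T).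
  by rewrite measurable_subE => /subG.
pose nu (B : set TG) := (\int[P]_(w in B) (Z w)%:E)%E.
have nu0 : nu set0 = 0%E by exact: integral_set0.
have nu_ge0 B : (0 <= nu B)%E by apply: integral_ge0 => w _; rewrite lee_fin.
have nu_sigma_additive : semi_sigma_additive nu.
  move=> F mF tF mUF; rewrite /nu ge0_integral_bigcup//.
  - apply: is_cvg_ereal_nneg_natsum_cond => n _ _.
    by apply: integral_ge0 => w _; rewrite lee_fin.
  - by move=> n; exact: mG.
  - exact: measurable_funTS (measurable_int _ iZ).
  - by move=> w _; rewrite lee_fin.
have nu_fin : fin_num_fun nu.
  move=> B mB; apply: integrable_fin_num => //; first exact: mG.
  by apply: (integrableS measurableT) => //; exact: mG.
pose nuM := isMeasure.Build _ TG R nu nu0 nu_ge0 nu_sigma_additive.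
pose nu1 : {measure set TG -> \bar R} := HB.pack nu nuM.
pose nuF := Measure_isFinite.Build _ TG R nu1 nu_fin.
pose nu2 : {finite_measure set TG -> \bar R} := HB.pack nu nuM nuF.
have mid : measurable_fun setT (id : T -> TG).
  by move=> _ B mB; rewrite setTI; exact: mG.
pose mu0 : {measure set TG -> \bar R} := pushforward P (id : T -> TG).
pose mu1 := mu0 mid.
have mu_fin : fin_num_fun mu1.
  by move=> B mB; apply: fin_num_measure; exact: mG.
pose muF := Measure_isFinite.Build _ TG R mu1 mu_fin.
pose mu : {finite_measure set TG -> \bar R} := HB.pack (Measure.sort mu1) muF.
have numu : nu2 `<< mu.
  apply/null_content_dominatesP => A mA; rewrite /mu /= /pushforward/= => PA0.
  apply: null_set_integral; [exact: mG|exact: measurable_funTS (measurable_int _ iZ)|].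
  exact: PA0.
have [V [V0 Vfin iV nuV]] := radon_nikodym_sigma_finite numu.
exists (fine \o V); split.
- apply: measurableT_comp => //; exact: measurable_int iV.
- by move=> w; rewrite fine_ge0.
- move=> B; rewrite -measurable_subE => mB.
  under eq_integral do rewrite /= fineK//.
  transitivity (nu2 B); last by [].
  rewrite nuV// /mu ge0_integral_pushforward//.
  exact: measurable_funTS (measurable_int _ iV).
Qed.

End sub_sigma_algebra.

(** * Exponential moments of dominated differences *)

(** [expR y <= 1 / (1 - y)], and [(1 - y) * (1 + y + 2 * y ^+ 2) = 1 + y ^+ 2 * (1 - 2 * y)] is at
    least 1 for [y <= 1 / 2]. *)
Lemma expR_le_quadratic (R : realType) (y : R) :
  y <= 1 / 2 -> expR y <= 1 + y + 2 * y ^+ 2.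
Proof.
move=> y2; have := expR_ge1Dx (- y); rewrite expRN => H.
have y0 : 0 < 1 - y by lra.
have : expR y * (1 - y) <= 1 by rewrite -ler_pdivlMl ?expR_gt0// mulr1.
have := expR_gt0 y; set e := expR y => e0 H1.
rewrite -(ler_pM2r y0); apply: le_trans H1 _.
have := sqr_ge0 y; nra.
Qed.

Section exponential_supermartingale.
Context d (T : measurableType d) (R : realType) (P : probability T R).

(* E(D | G) <= v, tested against bounded nonnegative [G]-measurable weights;
   the shift [c] keeps all integrands nonnegative. *)
Definition cond_dominated (G : set (set T)) (D v : T -> R) : Prop :=
  forall (W : T -> R) (K c : R),
    measurable_fun setT (W : g_sigma_algebraType G -> R) ->
    (forall w, 0 <= W w <= K) -> 0 <= c -> (forall w, 0 <= D w + c) ->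
    (\int[P]_w (W w * (D w + c))%:E <= \int[P]_w (W w * (v w + c))%:E)%E.

Variables (F : nat -> set (set T)) (D v : nat -> T -> R) (B lam : R).
Hypothesis sF : forall t, sigma_algebra setT (F t).
Hypothesis subF : forall t, F t `<=` measurable.
Hypothesis lam0 : 0 < lam.
Hypothesis lamB : lam * B <= 1 / 2.
Hypothesis DB : forall t w, `|D t w| <= B.
Hypothesis v0 : forall t w, 0 <= v t w.
Hypothesis mD : forall s t, (s < t)%N ->
  measurable_fun setT (D s : g_sigma_algebraType (F t) -> R).
Hypothesis mv : forall s t, (s <= t)%N ->
  measurable_fun setT (v s : g_sigma_algebraType (F t) -> R).
Hypothesis Dv : forall t, cond_dominated (F t) (D t) (v t).

(** Induction with the predictable weight [W], the past exponential times [expR (- (lam * v n w))].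
    The quadratic bound makes the new factor affine in [D n], domination replaces [D n] by [v n],
    and [1 + lam * v n + q <= expR (lam * v n + q)] with [q = 2 * (lam * B) ^+ 2]; the weight
    cancels all but [expR q]. *)
Lemma exp_moment n :
  (\int[P]_w (expR (lam * \sum_(t < n) (D t w - v t w)))%:E <=
   (expR (n%:R * (2 * (lam * B) ^+ 2)))%:E)%E.
Proof.
have mDT t : measurable_fun setT (D t).
  exact: (measurable_fun_sub (sF t.+1) (@subF t.+1) (mD (ltnSn t))).
have mvT t : measurable_fun setT (v t).
  exact: (measurable_fun_sub (sF t) (@subF t) (mv (leqnn t))).
elim: n => [|n IHn].
  under eq_integral do rewrite big_ord0 mulr0 expR0.
  by rewrite mul0r expR0 (integral_cst P measurableT 1%:E) mul1e probability_le1.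
pose S w := \sum_(t < n) (D t w - v t w).
have mST (G : set (set T)) :
    (forall t, (t < n)%N -> measurable_fun setT (D t : g_sigma_algebraType G -> R)) ->
    (forall t, (t < n)%N -> measurable_fun setT (v t : g_sigma_algebraType G -> R)) ->
    measurable_fun setT (S : g_sigma_algebraType G -> R).
  move=> mDG mvG; apply: measurable_sum => t.
  by apply: measurable_funB; [exact: mDG|exact: mvG].
have mS : measurable_fun setT S.
  by apply: measurable_sum => t; exact: measurable_funB.
pose W w := expR (lam * S w) * expR (- (lam * v n w)).
(* The shift for which [lam * (y + c) = 1 + lam * y + 2 * (lam * B) ^+ 2]. From [lam * B <= 1 / 2]
   follows [B <= lam^-1 <= c], so [D n w + c] is nonnegative. *)
pose c := lam^-1 + 2 * lam * B ^+ 2.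
have B0 : 0 <= B by exact: le_trans (normr_ge0 _) (DB 0 point).
have mW : measurable_fun setT (W : g_sigma_algebraType (F n) -> R).
  apply: measurable_funM; apply: measurableT_comp => //.
    apply: measurable_funM => //; apply: mST => t tn; [exact: mD|].
    by apply: mv; exact: ltnW.
  by apply: measurableT_comp => //; apply: measurable_funM => //; exact: mv.
have mWT : measurable_fun setT W := measurable_fun_sub (sF n) (@subF n) mW.
have WK w : 0 <= W w <= expR (lam * (n%:R * B)).
  rewrite /W mulr_ge0 ?expR_ge0//= -expRD ler_expR.
  have H1 : S w <= n%:R * B.
    rewrite -[X in X%:R](card_ord n) mulr_natl -sumr_const; apply: ler_sum => t _.
    by rewrite lerBlDr (le_trans (ler_norm _))// (le_trans (DB _ _))// lerDl.
  have := mulr_ge0 (ltW lam0) (v0 n w); have := ler_wpM2l (ltW lam0) H1; lra.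
have W0 w : 0 <= W w by have /andP[] := WK w.
have Dc w : 0 <= D n w + c.
  have := DB n w; rewrite ler_norml => /andP[DB1 _].
  suff : B <= c by lra.
  apply: (@le_trans _ _ lam^-1).
    by rewrite -(ler_pM2l lam0) divff ?gt_eqF// (le_trans lamB)//; lra.
  by rewrite lerDl !mulr_ge0// ?sqr_ge0// ltW.
have c0 : 0 <= c.
  by rewrite addr_ge0 ?invr_ge0 ?(ltW lam0)// !mulr_ge0// ?sqr_ge0// ltW.
have vc w : 0 <= v n w + c by rewrite addr_ge0.
have lamc w : lam * (w + c) = 1 + lam * w + 2 * (lam * B) ^+ 2.
  by rewrite /c; field; rewrite gt_eqF.
apply: (@le_trans _ _ (\int[P]_w (lam%:E * (W w * (D n w + c))%:E))%E).
  apply: ge0_le_integral => //.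
  - apply/measurable_EFinP; apply: measurableT_comp => //.
    apply: measurable_funM => //; apply: measurable_sum => t.
    exact: measurable_funB.
  - apply/measurable_EFinP; apply: measurable_funM => //.
    by apply: measurable_funM => //; exact: measurable_funD.
  - move=> w _; rewrite -EFinM lee_fin mulrCA lamc big_ord_recr/=.
    rewrite -/(S w) mulrDr mulrBr [_ + (_ - _)]addrCA addrC -addrA expRD.
    rewrite [leLHS](_ : _ = W w * expR (lam * D n w)); last first.
      by rewrite /W expRD; ring.
    apply: ler_wpM2l => //.
    have lamD : `|lam * D n w| <= lam * B by rewrite normrM gtr0_norm// ler_pM2l.
    apply: le_trans (expR_le_quadratic _) _.
      by rewrite (le_trans (ler_norm _))// (le_trans lamD).
    rewrite lerD2l ler_wpM2l// -[in leLHS]real_normK ?num_real//.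
    by rewrite ler_sqr ?nnegrE// mulr_ge0// ltW.
rewrite ge0_integralZl_EFin//; last 3 first.
- by move=> w _; rewrite lee_fin mulr_ge0.
- apply/measurable_EFinP; apply: measurable_funM => //.
  exact: measurable_funD.
- exact: ltW.
apply: (@le_trans _ _ (lam%:E * \int[P]_w (W w * (v n w + c))%:E)%E).
  rewrite lee_wpmul2l// ?lee_fin ?(ltW lam0)//.
  exact: (Dv mW WK c0 Dc).
rewrite -ge0_integralZl_EFin//; last 3 first.
- by move=> w _; rewrite lee_fin mulr_ge0.
- apply/measurable_EFinP; apply: measurable_funM => //.
  exact: measurable_funD.
- exact: ltW.
apply: (@le_trans _ _ (\int[P]_w ((expR (2 * (lam * B) ^+ 2))%:E *
    (expR (lam * S w))%:E))%E).
  apply: ge0_le_integral => //.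
  - by move=> w _; rewrite -EFinM lee_fin mulr_ge0 ?mulr_ge0// ltW.
  - apply/measurable_EFinP; apply: measurable_funM => //.
    by apply: measurable_funM => //; exact: measurable_funD.
  - apply/measurable_EFinP; apply: measurable_funM => //.
    by apply: measurableT_comp => //; exact: measurable_funM.
  - move=> w _; rewrite -!EFinM lee_fin mulrCA lamc /W -mulrA [leRHS]mulrC.
    rewrite ler_wpM2l ?expR_ge0// expRN ler_pdivrMl ?expR_gt0// -expRD.
    by apply: le_trans (expR_ge1Dx _); rewrite addrA.
rewrite ge0_integralZl_EFin ?expR_ge0//; last first.
  by apply/measurable_EFinP; apply: measurableT_comp => //; exact: measurable_funM.
set q := 2 * (lam * B) ^+ 2 in IHn *.
have -> : n.+1%:R * q = q + n%:R * q by rewrite -[n.+1%:R]natr1 mulrDl mul1r addrC.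
rewrite expRD EFinM.
by rewrite lee_wpmul2l// lee_fin expR_ge0.
Qed.

End exponential_supermartingale.

(** * Almost sure finiteness of nonnegative series *)

Section almost_sure_bounds.
Context d (T : measurableType d) (R : realType) (P : probability T R).

Lemma ae_bounded_partial_sums (Z : nat -> T -> R) (A : R) :
  (forall i, measurable_fun setT (Z i)) -> (forall i w, 0 <= Z i w) ->
  (forall n, (\sum_(i < n) \int[P]_w (Z i w)%:E <= A%:E)%E) ->
  {ae P, forall w, exists C, forall n, \sum_(i < n) Z i w <= C}.
Proof.
move=> mZ Z0 ZA.
pose Sigma w := (\sum_(i <oo) (Z i w)%:E)%E.
have iS : P.-integrable setT Sigma.
  apply/integrableP; split.
    apply: ge0_emeasurable_sum => [i w _ _|i _]; first by rewrite lee_fin.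
    exact/measurable_EFinP.
  have absS w : `|Sigma w|%E = Sigma w.
    by rewrite gee0_abs// nneseries_ge0// => i _ _; rewrite lee_fin.
  under eq_integral do rewrite absS.
  rewrite integral_nneseries//; last 2 first.
  - by move=> i; exact/measurable_EFinP.
  - by move=> i w _; rewrite lee_fin.
  apply: (@le_lt_trans _ _ A%:E); last by rewrite ltry.
  apply: lime_le.
    apply: is_cvg_nneseries => i _ _.
    by apply: integral_ge0 => w _; rewrite lee_fin.
  by apply: nearW => n; rewrite big_mkord.
have := integrable_ae measurableT iS.
apply: filterS => w /(_ I) Sfin.
exists (fine (Sigma w)) => n; rewrite -lee_fin fineK// -sumEFin.
rewrite -(big_mkord xpredT (fun i => (Z i w)%:E)).
by apply: nneseries_lim_ge => i _ _; rewrite lee_fin.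
Qed.

End almost_sure_bounds.

(** * Almost sure bounds from moments *)

Section almost_sure_growth.
Context d (T : measurableType d) (R : realType) (P : probability T R).

(* Telescoping substitute for the convergence of the series of terms
   [t `^ - (1 + eps)]. *)
Lemma powRN_increment_ge (eps t : R) : 0 < eps -> 1 <= t ->
  eps / (2 + eps) * t `^ (- (1 + eps)) <= t `^ (- eps) - (t + 1) `^ (- eps).
Proof.
move=> e0 t1; have t0 : 0 < t by lra.
pose u := eps / (t + 1).
have u0 : 0 < u by rewrite divr_gt0//; lra.
have tE : (t + 1) `^ (- eps) <= t `^ (- eps) * expR (- u).
  rewrite /powR !gt_eqF//; last lra.
  rewrite -expRD ler_expR.
  have : (t + 1)^-1 <= ln (t + 1) - ln t.
    have H : 0 < t / (t + 1) by rewrite divr_gt0//; lra.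
    have := ln_leB1 H; rewrite ln_div ?posrE//; last lra.
    have -> : t / (t + 1) = 1 - (t + 1)^-1 by field; lra.
    lra.
  rewrite -(ler_pM2l e0) mulrBr -/u; lra.
apply: (@le_trans _ _ (t `^ (- eps) * (1 - expR (- u)))); last first.
  by rewrite mulrBr mulr1 lerB.
have -> : - (1 + eps) = - eps + - 1 by lra.
rewrite powRD; last by rewrite (gt_eqF t0) implybT.
rewrite powR_inv1 ?(ltW t0)// mulrCA ler_wpM2l ?powR_ge0//.
(* The left side is [eps / (t + 1 + eps)], at least [eps / ((2 + eps) * t)] because [1 <= t]. *)
have H1 : u / (1 + u) <= 1 - expR (- u).
  have := expR_ge1Dx u => Hu.
  rewrite expRN ler_pdivrMr; last lra.
  have : (expR u)^-1 * (1 + u) <= (expR u)^-1 * expR u.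
    by rewrite ler_wpM2l ?invr_ge0 ?expR_ge0.
  rewrite mulVf ?gt_eqF ?expR_gt0//; lra.
apply: le_trans H1.
have -> : u / (1 + u) = eps / (t + 1 + eps).
  by rewrite /u; field; apply/andP; split; lra.
rewrite -mulrA ler_wpM2l ?(ltW e0)// -invfM lef_pV2 ?posrE; nra.
Qed.

Lemma ae_partial_sums_growth (Z : nat -> T -> R) (A eps : R) :
  0 < eps -> (forall i, measurable_fun setT (Z i)) -> (forall i w, 0 <= Z i w) ->
  (forall i, (\int[P]_w (Z i w)%:E <= A%:E)%E) ->
  {ae P, forall w, exists C, 0 <= C /\
     forall n, \sum_(i < n) Z i w <= C * n%:R `^ (1 + eps)}.
Proof.
move=> e0 mZ Z0 ZA.
pose a (i : nat) : R := i.+1%:R `^ (- eps) - i.+2%:R `^ (- eps).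
have i1 (i : nat) : 1 <= i.+1%:R :> R by rewrite ler1n.
pose c := eps / (2 + eps).
have c0 : 0 < c by rewrite divr_gt0//; lra.
have a_ge i : c * i.+1%:R `^ (- (1 + eps)) <= a i.
  by rewrite /a -[i.+2%:R]natr1; exact: powRN_increment_ge.
have a0 i : 0 <= a i by apply: le_trans (a_ge i); rewrite mulr_ge0 ?powR_ge0// ltW.
have sum_a n : \sum_(i < n) a i <= 1.
  suff -> : \sum_(i < n) a i = 1 - n.+1%:R `^ (- eps) by rewrite gerBl powR_ge0.
  elim: n => [|n IHn]; first by rewrite big_ord0 powR1 subrr.
  by rewrite big_ord_recr /= IHn /a; ring.
have A0 : 0 <= A.
  rewrite -lee_fin; apply: le_trans (ZA 0).
  by apply: integral_ge0 => w _; rewrite lee_fin.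
have : {ae P, forall w, exists C, forall n, \sum_(i < n) a i * Z i w <= C}.
  apply: (@ae_bounded_partial_sums _ _ _ _ (fun i w => a i * Z i w) A).
  - by move=> i; exact: measurable_funM.
  - by move=> i w; rewrite mulr_ge0.
  - move=> n; apply: (@le_trans _ _ (\sum_(i < n) (a i * A)%:E)%E).
      apply: lee_sum => i _.
      under eq_integral do rewrite EFinM.
      rewrite ge0_integralZl_EFin//; last 2 first.
      - by move=> w _; rewrite lee_fin.
      - exact/measurable_EFinP.
      by rewrite EFinM lee_wpmul2l// lee_fin.
    rewrite sumEFin lee_fin -mulr_suml -[leRHS]mul1r.
    by rewrite ler_wpM2r.
apply: filterS => w [C HC]; exists (c^-1 * C).
have C0 : 0 <= C by have := HC 0; rewrite big_ord0.
split=> [|n]; first by rewrite mulr_ge0// invr_ge0 ltW.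
rewrite -mulrA ler_pdivlMl// mulr_sumr.
have [->|n0] := posnP n; first by rewrite big_ord0 mulr_ge0 ?powR_ge0.
have npow : 0 < n%:R `^ (1 + eps) :> R by rewrite powR_gt0// ltr0n.
rewrite -ler_pdivrMr// mulr_suml; apply: le_trans (HC n).
apply: ler_sum => i _; rewrite mulrAC ler_wpM2r//.
apply: le_trans (a_ge i); rewrite ler_wpM2l ?(ltW c0)//.
rewrite powRN lef_pV2 ?posrE ?powR_gt0 ?ltr0n//.
by rewrite ge0_ler_powR ?nnegrE ?ler_nat//; lra.
Qed.

Variables (F : nat -> set (set T)) (D v : nat -> nat -> nat -> T -> R).
Variables (B : nat -> R) (n0 : nat).
Hypothesis sF : forall t, sigma_algebra setT (F t).
Hypothesis subF : forall t, F t `<=` measurable.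
Hypothesis B0 : forall n, (n0 <= n)%N -> 0 < B n.
Hypothesis DB : forall n j t w, (n0 <= n)%N -> `|D n j t w| <= B n.
Hypothesis v0 : forall n j t w, 0 <= v n j t w.
Hypothesis mD : forall n j s t, (s < t)%N ->
  measurable_fun setT (D n j s : g_sigma_algebraType (F t) -> R).
Hypothesis mv : forall n j s t, (s <= t)%N ->
  measurable_fun setT (v n j s : g_sigma_algebraType (F t) -> R).
Hypothesis Dv : forall n j t, (n0 <= n)%N ->
  cond_dominated P (F t) (D n j t) (v n j t).

(** Each exponential has mean at most [n], so their sum [U n] over the [n ^ 4] indices has mean at
    most [n ^ 5]. The growth bound with exponent 2 for [n%:R ^- 5 * U n] then bounds every single
    exponential by a constant times [n ^ 7]; taking logarithms and dividing by [lam n] gives the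
    claim. *)
Lemma ae_uniform_deviation :
  {ae P, forall w, exists C, forall n j, (n0 <= n)%N -> (2 <= n)%N -> (j < n ^ 4)%N ->
     \sum_(t < n) (D n j t w - v n j t w) <=
       C * (B n * Num.sqrt (n%:R * ln n%:R))}.
Proof.
(* This choice makes the exponent [n * 2 * (lam n * B n) ^+ 2] equal to [ln n / 2], while
   [lam n * B n <= 1 / 2]. *)
pose lam (n : nat) : R := Num.sqrt (ln n%:R / n%:R) / (2 * B n).
pose U n w := \sum_(j < n ^ 4) expR (lam n * \sum_(t < n) (D n j t w - v n j t w)).
pose Z n w := if (n0 <= n)%N && (2 <= n)%N then n%:R ^- 5 * U n w else 0.
have mDT n j t : measurable_fun setT (D n j t).
  exact: (measurable_fun_sub (sF t.+1) (@subF t.+1) (mD n j (ltnSn t))).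
have mvT n j t : measurable_fun setT (v n j t).
  exact: (measurable_fun_sub (sF t) (@subF t) (mv n j (leqnn t))).
have mE n j : measurable_fun setT
    (fun w => expR (lam n * \sum_(t < n) (D n j t w - v n j t w))).
  apply: measurableT_comp => //; apply: measurable_funM => //.
  by apply: measurable_sum => t; exact: measurable_funB.
have mU n : measurable_fun setT (U n) by apply: measurable_sum => j.
have U0 n w : 0 <= U n w by apply: sumr_ge0 => j _; exact: expR_ge0.
have mZ n : measurable_fun setT (Z n).
  rewrite /Z; case: (_ && _); [exact: measurable_funM|exact: measurable_cst].
have Z0 n w : 0 <= Z n w.
  by rewrite /Z; case: ifP => // _; rewrite mulr_ge0// invr_ge0 exprn_ge0.
have facts n : (n0 <= n)%N -> (2 <= n)%N ->
    [/\ 0 < n%:R :> R, 0 < ln n%:R :> R, 0 < lam n, lam n * B n <= 1 / 2 &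
        n%:R * (2 * (lam n * B n) ^+ 2) <= ln n%:R].
  move=> n0n n2; have nR : 2 <= n%:R :> R by rewrite ler_nat.
  have nR0 : 0 < n%:R :> R by lra.
  have l0 : 0 < ln n%:R :> R by rewrite ln_gt0//; lra.
  have q0 : 0 < ln n%:R / n%:R :> R by rewrite divr_gt0.
  have Bn := B0 n0n.
  have lB : lam n * B n = Num.sqrt (ln n%:R / n%:R) / 2.
    by rewrite /lam; field; rewrite gt_eqF.
  split=> //.
  - by rewrite divr_gt0 ?sqrtr_gt0// mulr_gt0.
  - rewrite lB ler_pM2r ?invr_gt0// -[leRHS]sqrtr1 ler_sqrt// ler_pdivrMr// mul1r.
    by have := ln_leB1 nR0; lra.
  - rewrite lB expr_div_n sqr_sqrtr ?(ltW q0)//.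
    have -> : n%:R * (2 * (ln n%:R / n%:R / 2 ^+ 2)) = ln n%:R / 2 :> R.
      by field; rewrite gt_eqF.
    lra.
have ZA n : (\int[P]_w (Z n w)%:E <= 1%:E)%E.
  rewrite /Z; case: (boolP (_ && _)) => [/andP[n0n n2]|_]; last by rewrite integral0_eq.
  have [nR0 l0 lam0 lamB lamn] := facts n n0n n2.
  under eq_integral do rewrite EFinM -sumEFin.
  have n5 : 0 < n%:R ^+ 5 :> R by rewrite exprn_gt0.
  rewrite ge0_integralZl_EFin//; last 2 first.
  - by move=> w _; rewrite sumEFin lee_fin; exact: U0.
  - under eq_fun do rewrite sumEFin.
    exact/measurable_EFinP/mU.
  rewrite ge0_integral_sum//; last by move=> j; exact/measurable_EFinP.
  apply: (@le_trans _ _ ((n%:R ^- 5)%:E * \sum_(j < n ^ 4) (n%:R : R)%:E)%E); last first.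
    rewrite sumEFin -EFinM lee_fin sumr_const card_ord.
    rewrite -[X in _ * X]mulr_natr natrX.
    by rewrite -exprS mulVf// gt_eqF.
  rewrite lee_wpmul2l ?lee_fin ?invr_ge0 ?(ltW n5)//.
  apply: lee_sum => j _.
  apply: le_trans (@exp_moment _ _ _ P F (D n j) (v n j) (B n) (lam n) sF subF
    lam0 lamB _ _ _ _ _ n) _ => //.
  - by move=> t w; exact: DB.
  - by move=> s t; exact: mD.
  - by move=> s t; exact: mv.
  - by move=> t; exact: Dv.
  - by rewrite lee_fin -[leRHS]lnK ?posrE// ler_expR.
have := ae_partial_sums_growth ltr01 mZ Z0 ZA.
apply: filterS => w [C [C0 HC]].
(* The 7 comes from [n ^ 7], the factor 2 from the denominator of [lam n]; dividing by [ln 2] turns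
   the constant into a multiple of [ln n], as [2 <= n]. *)
exists (2 * (`|ln (4 * (C + 1))| / ln 2 + 7)) => n j n0n n2 jn.
have [nR0 l0 lam0 lamB lamn] := facts n n0n n2.
set S := \sum_(t < n) _.
have nR : 2 <= n%:R :> R by rewrite ler_nat.
have expS : expR (lam n * S) <= 4 * (C + 1) * n%:R ^+ 7.
  have : expR (lam n * S) <= U n w.
    rewrite /U (bigD1 (Ordinal jn))//= lerDl.
    by apply: sumr_ge0 => i _; exact: expR_ge0.
  move=> /le_trans; apply.
  have : Z n w <= C * n.+1%:R `^ (1 + 1).
    by apply: le_trans (HC n.+1); rewrite big_ord_recr/= lerDr sumr_ge0.
  rewrite /Z n0n n2/= ler_pdivrMl ?exprn_gt0// => /le_trans; apply.
  rewrite -[1 + 1]/(2%:R) powR_mulrn// -[n.+1%:R]natr1.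
  have n5 : 0 <= n%:R ^+ 5 :> R by rewrite exprn_ge0// ltW.
  have -> : 4 * (C + 1) * n%:R ^+ 7 = n%:R ^+ 5 * ((C + 1) * (2 * n%:R) ^+ 2) :> R by ring.
  rewrite ler_wpM2l//; apply: ler_pM => //; first lra.
  rewrite ler_sqr ?nnegrE; lra.
have lamS : lam n * S <= ln (4 * (C + 1)) + 7 * ln n%:R.
  rewrite -[leLHS]expRK.
  have -> : 7 * ln n%:R = ln (n%:R ^+ 7) :> R by rewrite lnXn// mulr_natl.
  rewrite -lnM ?posrE ?exprn_gt0//; last lra.
  by rewrite ler_ln ?posrE ?expR_gt0// mulr_gt0 ?exprn_gt0//; lra.
have ln2 : 0 < ln 2 :> R by rewrite ln_gt0//; lra.
have lamS' : lam n * S <= (`|ln (4 * (C + 1))| / ln 2 + 7) * ln n%:R.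
  apply: le_trans lamS _; rewrite [leRHS]mulrDl lerD2r.
  apply: le_trans (ler_norm _) _.
  rewrite -mulrA ler_peMr// ler_pdivlMl// mulr1.
  by rewrite ler_ln ?posrE//; lra.
have Bn := B0 n0n.
set C' := _ + 7 in lamS' *.
rewrite -(ler_pM2l lam0); apply: le_trans lamS' _.
have sq : Num.sqrt (ln n%:R / n%:R) * Num.sqrt (n%:R * ln n%:R) = ln n%:R :> R.
  rewrite -sqrtrM; last by rewrite divr_ge0 ?ltW.
  have -> : ln n%:R / n%:R * (n%:R * ln n%:R) = ln n%:R ^+ 2 :> R.
    by field; rewrite gt_eqF.
  by rewrite sqrtr_sqr gtr0_norm.
rewrite [leRHS](_ : _ = C' * (Num.sqrt (ln n%:R / n%:R) * Num.sqrt (n%:R * ln n%:R))).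
  by rewrite sq.
by rewrite /lam; field; rewrite gt_eqF.
Qed.

End almost_sure_growth.

(** * Integrals of nonnegative real functions *)

Section real_integrands.
Context d (T : measurableType d) (R : realType) (P : probability T R).
Implicit Types f g : T -> R.

Lemma ge0_integralD_real f g :
  measurable_fun setT f -> (forall w, 0 <= f w) ->
  measurable_fun setT g -> (forall w, 0 <= g w) ->
  (\int[P]_w (f w + g w)%:E = \int[P]_w (f w)%:E + \int[P]_w (g w)%:E)%E.
Proof.
move=> mf f0 mg g0; rewrite -ge0_integralD//.
- by move=> w _; rewrite lee_fin.
- exact/measurable_EFinP.
- by move=> w _; rewrite lee_fin.
- exact/measurable_EFinP.
Qed.

Lemma ge0_integralZ_real (q : R) f : 0 <= q ->
  measurable_fun setT f -> (forall w, 0 <= f w) ->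
  (\int[P]_w (q * f w)%:E = q%:E * \int[P]_w (f w)%:E)%E.
Proof.
move=> q0 mf f0; rewrite -ge0_integralZl_EFin//.
- by move=> w _; rewrite lee_fin.
- exact/measurable_EFinP.
Qed.

Lemma ge0_le_integral_real f g :
  measurable_fun setT f -> (forall w, 0 <= f w) ->
  measurable_fun setT g -> (forall w, f w <= g w) ->
  (\int[P]_w (f w)%:E <= \int[P]_w (g w)%:E)%E.
Proof.
move=> mf f0 mg fg; apply: ge0_le_integral => //.
- by move=> w _; rewrite lee_fin.
- exact/measurable_EFinP.
- exact/measurable_EFinP.
- by move=> w _; rewrite lee_fin.
Qed.

Lemma weighted_integral_fin_num (W U : T -> R) (K : R) :
  measurable_fun setT W -> (forall w, 0 <= W w <= K) ->
  P.-integrable setT (EFin \o U) -> (forall w, 0 <= U w) ->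
  (\int[P]_w (W w * U w)%:E)%E \is a fin_num.
Proof.
move=> mW WK iU U0.
have W0 w : 0 <= W w by have /andP[] := WK w.
have mU : measurable_fun setT U by apply/measurable_EFinP; exact: measurable_int iU.
have K0 : 0 <= K by have /andP[/le_trans] := WK point; apply.
rewrite ge0_fin_numE; last by apply: integral_ge0 => w _; rewrite lee_fin mulr_ge0.
apply: (@le_lt_trans _ _ (\int[P]_w (K * U w)%:E)%E).
  apply: ge0_le_integral_real; [exact: measurable_funM| |exact: measurable_funM|].
    by move=> w; rewrite mulr_ge0.
  by move=> w; rewrite ler_wpM2r//; case/andP: (WK w).
rewrite ge0_integralZ_real// lte_mul_pinfty//.
by have := integrable_lty measurableT iU.
Qed.

End real_integrands.

(** * Conditional domination of truncated residuals and of indicators *)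

Section conditional_domination.
Context d (T : measurableType d) (R : realType) (P : probability T R).
Variable G : set (set T).
Hypothesis sG : sigma_algebra setT G.
Hypothesis subG : G `<=` measurable.

Local Notation TG := (g_sigma_algebraType G).

Lemma ge0_integral_weight_real (W U1 U2 : T -> R) :
  measurable_fun setT U1 -> measurable_fun setT U2 ->
  (forall w, 0 <= U1 w) -> (forall w, 0 <= U2 w) ->
  (forall E, G E -> (\int[P]_(w in E) (U1 w)%:E = \int[P]_(w in E) (U2 w)%:E)%E) ->
  measurable_fun setT (W : TG -> R) -> (forall w, 0 <= W w) ->
  (\int[P]_w (W w * U1 w)%:E = \int[P]_w (W w * U2 w)%:E)%E.
Proof.
move=> mU1 mU2 U10 U20 U12 mW W0.
have := @ge0_integral_weight _ _ _ P _ sG subG (EFin \o U1) (EFin \o U2) W.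
apply=> //; exact/measurable_EFinP.
Qed.

(** [A] and [B] have the same conditional expectation and [k] is known given [G], so [k * (A - B)]
    averages out and only [q * E(Z | G) = q * V] remains. *)
Lemma cond_dominated_truncation (D A B Z V k : T -> R) (q : R) :
  measurable_fun setT D ->
  P.-integrable setT (EFin \o A) -> (forall w, 0 <= A w) ->
  P.-integrable setT (EFin \o B) -> (forall w, 0 <= B w) ->
  (forall E, G E -> (\int[P]_(w in E) (A w)%:E = \int[P]_(w in E) (B w)%:E)%E) ->
  measurable_fun setT Z -> (forall w, 0 <= Z w) ->
  measurable_fun setT (V : TG -> R) -> (forall w, 0 <= V w) ->
  (forall E, G E -> (\int[P]_(w in E) (V w)%:E = \int[P]_(w in E) (Z w)%:E)%E) ->
  measurable_fun setT (k : TG -> R) -> (forall w, 0 <= k w <= 1) ->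
  0 <= q -> (forall w, D w <= k w * (A w - B w) + q * Z w) ->
  cond_dominated P G D (fun w => q * V w).
Proof.
move=> mD iA A0 iB B0 AB mZ Z0 mV V0 VZ mk k01 q0 DAB W K c mW WK c0 Dc.
have mA : measurable_fun setT A by apply/measurable_EFinP; exact: measurable_int iA.
have mB : measurable_fun setT B by apply/measurable_EFinP; exact: measurable_int iB.
have mWT : measurable_fun setT W := measurable_fun_sub sG subG mW.
have mkT : measurable_fun setT k := measurable_fun_sub sG subG mk.
have mVT : measurable_fun setT V := measurable_fun_sub sG subG mV.
have W0 w : 0 <= W w by have /andP[] := WK w.
have k0 w : 0 <= k w by have /andP[] := k01 w.
have mWk : measurable_fun setT ((fun w => W w * k w) : TG -> R) by exact: measurable_funM.
have mWkT : measurable_fun setT (fun w => W w * k w) by exact: measurable_funM.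
have WkB : (\int[P]_w (W w * k w * B w)%:E)%E \is a fin_num.
  apply: (weighted_integral_fin_num (K := K)) => // w.
  rewrite mulr_ge0//=; have /andP[W1 W2] := WK w; apply: le_trans W2.
  by rewrite ler_piMr//; case/andP: (k01 w).
have WAB : (\int[P]_w (W w * k w * A w)%:E = \int[P]_w (W w * k w * B w)%:E)%E.
  by apply: ge0_integral_weight_real => // w; rewrite mulr_ge0.
have WVZ : (\int[P]_w (W w * V w)%:E = \int[P]_w (W w * Z w)%:E)%E.
  exact: ge0_integral_weight_real.
have mWc : measurable_fun setT (fun w => W w * c) by exact: measurable_funM.
have Wc0 w : 0 <= W w * c by rewrite mulr_ge0.
have splitE (U : T -> R) : measurable_fun setT U -> (forall w, 0 <= U w) ->
    (\int[P]_w (W w * (q * U w + c))%:E =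
     q%:E * \int[P]_w (W w * U w)%:E + \int[P]_w (W w * c)%:E)%E.
  move=> mU U0.
  have mWU : measurable_fun setT (fun w => W w * U w) by exact: measurable_funM.
  have WU0 w : 0 <= W w * U w by rewrite mulr_ge0.
  rewrite -ge0_integralZ_real// -ge0_integralD_real//; last 2 first.
  - exact: measurable_funM.
  - by move=> w; rewrite mulr_ge0.
  by apply: eq_integral => w _; congr EFin; ring.
(* Adding the finite integral of [W * k * B] to both sides, and reading it as that of [W * k * A] on
   the right, avoids subtracting integrals; what remains holds pointwise. *)
rewrite -(leeD2rE _ _ WkB) splitE// WVZ -splitE// -[X in (_ <= _ + X)%E]WAB.
have mWD : measurable_fun setT (fun w => W w * (D w + c)).
  by apply: measurable_funM => //; exact: measurable_funD.
have WD0 w : 0 <= W w * (D w + c) by rewrite mulr_ge0.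
have mWkU (U : T -> R) : measurable_fun setT U -> measurable_fun setT (fun w => W w * k w * U w).
  by move=> mU; exact: measurable_funM.
have WkU0 (U : T -> R) : (forall w, 0 <= U w) -> forall w, 0 <= W w * k w * U w.
  by move=> U0 w; rewrite !mulr_ge0.
have mWZ : measurable_fun setT (fun w => W w * (q * Z w + c)).
  apply: measurable_funM => //; apply: measurable_funD => //.
  exact: measurable_funM.
have WZ0 w : 0 <= W w * (q * Z w + c) by rewrite mulr_ge0// addr_ge0// mulr_ge0.
rewrite -!ge0_integralD_real//; [|exact: mWkU|exact: WkU0|exact: mWkU|exact: WkU0].
apply: ge0_le_integral_real.
- by apply: measurable_funD => //; exact: mWkU.
- by move=> w; rewrite addr_ge0// WkU0.
- by apply: measurable_funD => //; exact: mWkU.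
- move=> w; have := ler_wpM2l (W0 w) (DAB w); lra.
Qed.

(** A version [p] of the conditional probability may exceed 1 at some outcomes; the cap at 1 keeps
    the compensator nonnegative everywhere and only increases [1 - p]. *)
Lemma cond_dominated_indicator (U p : T -> R) :
  measurable_fun setT U -> (forall w, 0 <= U w <= 1) ->
  measurable_fun setT (p : TG -> R) -> (forall w, 0 <= p w) ->
  (forall E, G E -> (\int[P]_(w in E) (p w)%:E = \int[P]_(w in E) (U w)%:E)%E) ->
  cond_dominated P G (fun w => 1 - U w) (fun w => 1 - Num.min 1 (p w)).
Proof.
move=> mU U01 mp p0 pU W K c mW WK c0 Dc.
have mWT : measurable_fun setT W := measurable_fun_sub sG subG mW.
have mpT : measurable_fun setT p := measurable_fun_sub sG subG mp.
have W0 w : 0 <= W w by have /andP[] := WK w.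
have U0 w : 0 <= U w by have /andP[] := U01 w.
have iU : P.-integrable setT (EFin \o U).
  apply: measurable_bounded_integrable => //.
    by rewrite (le_lt_trans (probability_le1 _ _))// ltry.
  exists 1; split => // y y1 w _ /=; rewrite ger0_norm//.
  by have /andP[_ /le_trans] := U01 w; apply; exact: ltW.
have WU : (\int[P]_w (W w * U w)%:E)%E \is a fin_num.
  exact: (weighted_integral_fin_num (K := K)).
have WpU : (\int[P]_w (W w * p w)%:E = \int[P]_w (W w * U w)%:E)%E.
  exact: ge0_integral_weight_real.
have v0 w : 0 <= 1 - Num.min 1 (p w) by rewrite subr_ge0 ge_min lexx.
have mv : measurable_fun setT (fun w => 1 - Num.min 1 (p w)).
  by apply: measurable_funB => //; exact: measurable_minr.
have mWU : measurable_fun setT (fun w => W w * U w) by exact: measurable_funM.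
have mWp : measurable_fun setT (fun w => W w * p w) by exact: measurable_funM.
have mWD : measurable_fun setT (fun w => W w * (1 - U w + c)).
  apply: measurable_funM => //; apply: measurable_funD => //.
  exact: measurable_funB.
have mWv : measurable_fun setT (fun w => W w * (1 - Num.min 1 (p w) + c)).
  by apply: measurable_funM => //; exact: measurable_funD.
rewrite -(leeD2rE _ _ WU) -[X in (_ <= _ + X)%E]WpU -!ge0_integralD_real//.
- apply: ge0_le_integral_real.
  + exact: measurable_funD.
  + by move=> w; rewrite addr_ge0// mulr_ge0.
  + exact: measurable_funD.
  + move=> w; have : Num.min 1 (p w) <= p w by rewrite ge_min lexx orbT.
    by move=> /(ler_wpM2l (W0 w)); lra.
- by move=> w; rewrite mulr_ge0// addr_ge0.
- by move=> w; rewrite mulr_ge0.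
- by move=> w; rewrite mulr_ge0.
- by move=> w; rewrite mulr_ge0.
Qed.

End conditional_domination.

(** * Residuals weighted by the kernel on a grid *)

Section filtrations.
Context d (T : measurableType d).

Lemma measurable_fun_mono d' (S : measurableType d') (G G' : set (set T)) (g : T -> S) :
  sigma_algebra setT G -> G `<=` G' ->
  measurable_fun setT (g : g_sigma_algebraType G -> S) ->
  measurable_fun setT (g : g_sigma_algebraType G' -> S).
Proof.
move=> sG GG' mg _ B mB.
apply: sub_sigma_algebra; apply: GG'; rewrite -(sigma_algebra_id sG).
exact: (mg measurableT B mB).
Qed.

Lemma measurable_fun_generated d' (S : measurableType d') (G : set (set T)) (g : T -> S) :
  preimage_set_system setT g measurable `<=` G ->
  measurable_fun setT (g : g_sigma_algebraType G -> S).
Proof.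
by move=> gG _ B mB; apply: sub_sigma_algebra; apply: gG; exists B.
Qed.

End filtrations.

Lemma powR_tail (R : realType) (M tau y : R) : 0 < M -> 0 < tau -> M < y ->
  y <= M `^ (- tau) * y `^ (tau + 1).
Proof.
move=> M0 tau0 My; have y0 : 0 < y by lra.
rewrite powRN ler_pdivlMl ?powR_gt0// powRD; last by rewrite (gt_eqF y0) implybT.
rewrite powRr1 ?(ltW y0)// ler_pM2r//.
by rewrite ge0_ler_powR ?nnegrE ?ltW.
Qed.

Section numerator.
Context d (T : measurableType d) (R : realType) (P : probability T R).
Variable F : nat -> set (set T).
Hypothesis sF : forall t, sigma_algebra setT (F t).
Hypothesis subF : forall t, F t `<=` measurable.
Hypothesis ndF : forall s t, (s <= t)%N -> F s `<=` F t.
Variables x u r : nat -> T -> R.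
Hypothesis mx : forall s t, (s <= t)%N ->
  measurable_fun setT (x s : g_sigma_algebraType (F t) -> R).
Hypothesis mr : forall s t, (s <= t)%N ->
  measurable_fun setT (r s : g_sigma_algebraType (F t) -> R).
Hypothesis mu : forall s t, (s < t)%N ->
  measurable_fun setT (u s : g_sigma_algebraType (F t) -> R).
Hypothesis x0 : forall t w, 0 <= x t w.
Variables (C0 tau A : R).
Hypothesis r_bounded : forall t w, `|r t w| <= C0.
Hypothesis cond_exp_u : forall t,
  is_cond_exp P (F t) (fun w => (u t w)%:E) (fun w => (r t w)%:E).
Hypothesis tau0 : 0 < tau.
Hypothesis moment_u : forall t, (\int[P]_w (`|u t w| `^ (tau + 1))%:E <= A%:E)%E.

Let muT t : measurable_fun setT (u t).
Proof. exact: (measurable_fun_sub (sF t.+1) (@subF t.+1) (mu (ltnSn t))). Qed.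

Let mrT t : measurable_fun setT (r t).
Proof. exact: (measurable_fun_sub (sF t) (@subF t) (mr (leqnn t))). Qed.

Let Z t w := `|u t w| `^ (tau + 1).

Let mZ t : measurable_fun setT (Z t).
Proof.
apply: (@measurableT_comp _ _ _ _ _ _ (fun y : R => y `^ (tau + 1))).
  exact: measurable_powR.
exact: measurableT_comp.
Qed.

Let Z0 t w : 0 <= Z t w. Proof. exact: powR_ge0. Qed.

Let iZ t : P.-integrable setT (EFin \o Z t).
Proof.
apply/integrableP; split; first exact/measurable_EFinP.
apply: le_lt_trans (ltry A); apply: le_trans (moment_u t).
by under eq_integral do rewrite /= ger0_norm ?powR_ge0//.
Qed.

(** Truncation destroys centering. The removed part lives on [M < |u|], where [|r| <= C0 <= M] gives
    [|u - r| <= 2 * |u| <= 2 * M]^ (- tau) * |u| [^ (tau + 1)]. The sign allows a two-sided bound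
    later. *)
Let cond_dominated_residual (sgn M : R) (k : T -> R) (V : T -> R) t :
  `|sgn| = 1 -> C0 <= M -> 0 < M ->
  measurable_fun setT (k : g_sigma_algebraType (F t) -> R) ->
  (forall w, 0 <= k w <= 1) ->
  measurable_fun setT (V : g_sigma_algebraType (F t) -> R) -> (forall w, 0 <= V w) ->
  (forall E, F t E -> (\int[P]_(w in E) (V w)%:E = \int[P]_(w in E) (Z t w)%:E)%E) ->
  cond_dominated P (F t)
    (fun w => sgn * ((u t w - r t w) * (if `|u t w| <= M then 1 else 0) * k w))
    (fun w => 2 * M `^ (- tau) * V w).
Proof.
move=> sgn1 CM M0 mk k01 mV V0 VZ.
have [iu _ ir ur] := cond_exp_u t.
(* Adding [S] makes [u] and [r] nonnegative without changing their difference or the equality of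
   their integrals over [F t]. *)
pose S w : R := `|u t w| + `|r t w|.
have S0 w : 0 <= S w by rewrite addr_ge0.
have iS : P.-integrable setT (EFin \o S).
  by apply: (integrableD measurableT (f := EFin \o (fun w => `|u t w|)%R)
    (g := EFin \o (fun w => `|r t w|)%R)); exact: integrable_norm.
pose A1 w : R := S w + u t w.
pose A2 w : R := S w + r t w.
have A10 w : 0 <= A1 w.
  by rewrite /A1 /S; have := ler_norm (- u t w); rewrite normrN; have := normr_ge0 (r t w); lra.
have A20 w : 0 <= A2 w.
  by rewrite /A2 /S; have := ler_norm (- r t w); rewrite normrN; have := normr_ge0 (u t w); lra.
have iA1 : P.-integrable setT (EFin \o A1).
  exact: (integrableD measurableT iS iu).
have iA2 : P.-integrable setT (EFin \o A2).
  exact: (integrableD measurableT iS ir).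
have A12 E : F t E -> (\int[P]_(w in E) (A1 w)%:E = \int[P]_(w in E) (A2 w)%:E)%E.
  move=> FE; have mE := @subF t _ FE.
  have iE (U : T -> \bar R) : P.-integrable setT U -> P.-integrable E U.
    exact: integrableS.
  rewrite /A1 /A2; under eq_integral do rewrite EFinD.
  rewrite integralD//; [|exact: iE|exact: iE].
  under [RHS]eq_integral do rewrite EFinD.
  rewrite integralD//; [|exact: iE|exact: iE].
  by congr (_ + _)%E; rewrite ur.
have mkT := measurable_fun_sub (sF t) (@subF t) mk.
have mD : measurable_fun setT
   (fun w => sgn * ((u t w - r t w) * (if `|u t w| <= M then 1 else 0) * k w)).
  apply: measurable_funM => //; apply: measurable_funM => //.
  apply: measurable_funM; first exact: measurable_funB.
  apply: measurable_fun_ifT => //.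
  by apply: measurable_fun_ler => //; exact: measurableT_comp.
have q0 : 0 <= 2 * M `^ (- tau) by rewrite mulr_ge0// powR_ge0.
have DA w : sgn * ((u t w - r t w) * (if `|u t w| <= M then 1 else 0) * k w) <=
    k w * (sgn * (A1 w - A2 w)) + 2 * M `^ (- tau) * Z t w.
  have -> : A1 w - A2 w = u t w - r t w by rewrite /A1 /A2; lra.
  have := k01 w; move=> /andP[k0 k1].
  have qZ : 0 <= 2 * M `^ (- tau) * Z t w by rewrite mulr_ge0.
  case: ifPn => uM; first by lra.
  rewrite mulr0 mul0r mulr0; move: uM; rewrite -ltNge => uM.
  have H1 : 2 * `|u t w| <= 2 * M `^ (- tau) * Z t w.
    by rewrite -mulrA ler_pM2l// powR_tail.
  have H2 : `|k w * (sgn * (u t w - r t w))| <= 2 * `|u t w|.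
    rewrite !normrM sgn1 mul1r ger0_norm//.
    apply: (@le_trans _ _ `|u t w - r t w|); first by rewrite ler_piMl.
    by apply: le_trans (ler_normB _ _) _; have := r_bounded t w; lra.
  by move: H2; rewrite ler_norml => /andP[]; lra.
have sgnE : sgn = 1 \/ sgn = -1.
  move: sgn1; have [s0|s0] := leP 0 sgn.
    by rewrite ger0_norm//; left.
  by rewrite ltr0_norm// => sE; right; lra.
case: sgnE => sE; rewrite sE in DA mD *.
- apply: (cond_dominated_truncation (sF t) (@subF t) (A := A1) (B := A2) (Z := Z t) (k := k)) => //.
  by move=> w; have := DA w; rewrite [1 * (_ - _)]mul1r.
- apply: (cond_dominated_truncation (sF t) (@subF t) (A := A2) (B := A1) (Z := Z t) (k := k)) => //.
  + by move=> E FE; rewrite A12.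
  + by move=> w; have := DA w; rewrite [-1 * (A1 w - A2 w)]mulN1r opprB.
Qed.

Variables (M h : nat -> R) (a b eps : R) (n0 : nat).
Hypothesis CM : forall n, (n0 <= n)%N -> C0 <= M n.
Hypothesis M0 : forall n, (n0 <= n)%N -> 0 < M n.
Hypothesis h0 : forall n, 0 < h n.
Hypotheses (a0 : 0 < a) (ab : a < b) (eps0 : 0 < eps).

Lemma ae_numerator_grid :
  {ae P, forall w, exists C, 0 <= C /\
    forall n j, (n0 <= n)%N -> (2 <= n)%N -> (j < n ^ 4)%N ->
    `|\sum_(t < n) (u t w - r t w) *
       nkernel (h n) (a + j%:R * ((b - a) / n%:R ^+ 4)) (x t w)| <=
    C * (M n * Num.sqrt (n%:R * ln n%:R) + M n `^ (- tau) * n%:R `^ (1 + eps))}.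
Proof.
(* All compensators are multiples of the same [V t], so a single growth bound serves every
   truncation level and every grid point. *)
have [V HV] := choice (fun t => cond_exp_exists (sF t) (@subF t) (iZ t) (Z0 t)).
have mV t : measurable_fun setT (V t : g_sigma_algebraType (F t) -> R) by case: (HV t).
have V0 t w : 0 <= V t w by case: (HV t).
have VZ t E : F t E -> (\int[P]_(w in E) (V t w)%:E = \int[P]_(w in E) (Z t w)%:E)%E.
  by case: (HV t) => _ _; apply.
have mVT t : measurable_fun setT (V t).
  exact: (measurable_fun_sub (sF t) (@subF t) (mV t)).
have growthZ := ae_partial_sums_growth eps0 mZ Z0 moment_u.
have moment_V t : (\int[P]_w (V t w)%:E <= A%:E)%E.
  rewrite VZ; first exact: moment_u.
  by case: (sF t) => F0 FD _; have := FD _ F0; rewrite setD0.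
have growthV := ae_partial_sums_growth eps0 mVT V0 moment_V.
pose c (n j : nat) : R := a + j%:R * ((b - a) / n%:R ^+ 4).
have c0 n j : 0 < c n j.
  by rewrite ltr_pwDl// mulr_ge0// divr_ge0 ?exprn_ge0// subr_ge0 ltW.
pose k n j t w := nkernel (h n) (c n j) (x t w).
have k01 n j t w : 0 <= k n j t w <= 1 by rewrite nkernel_ge0 nkernel_le1.
have mk n j s t : (s <= t)%N ->
    measurable_fun setT (k n j s : g_sigma_algebraType (F t) -> R).
  move=> st; apply: (measurableT_comp (measurable_nkernel (h n) (c n j))).
  exact: mx.
pose I n t w : R := if `|u t w| <= M n then 1 else 0.
have deviation sgn : `|sgn| = 1 -> {ae P, forall w, exists C, forall n j,
    (n0 <= n)%N -> (2 <= n)%N -> (j < n ^ 4)%N ->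
    \sum_(t < n) (sgn * ((u t w - r t w) * I n t w * k n j t w) -
        2 * M n `^ (- tau) * V t w) <=
      C * (2 * M n * Num.sqrt (n%:R * ln n%:R))}.
  move=> sgn1.
  apply: (@ae_uniform_deviation _ _ _ P F
    (fun n j t w => sgn * ((u t w - r t w) * I n t w * k n j t w))
    (fun n _ t w => 2 * M n `^ (- tau) * V t w)
    (* Where the truncation keeps the residual, [|u - r| <= M n + C0 <= 2 * M n]. *)
    (fun n => 2 * M n) n0 sF subF).
  - by move=> n n0n; rewrite mulr_gt0 ?M0.
  - move=> n j t w n0n; rewrite normrM sgn1 mul1r 2!normrM.
    have /andP[kge0 kle1] := k01 n j t w.
    rewrite (ger0_norm kge0).
    apply: (@le_trans _ _ (`|u t w - r t w| * `|I n t w|)).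
      by rewrite ler_piMr// mulr_ge0.
    rewrite /I; case: ifPn => uM; last first.
      by rewrite normr0 mulr0 mulr_ge0// ltW// M0.
    rewrite normr1 mulr1; apply: le_trans (ler_normB _ _) _.
    by have := r_bounded t w; have := CM n0n; lra.
  - by move=> n j t w; rewrite !mulr_ge0// powR_ge0.
  - move=> n j s t st; apply: measurable_funM => //; apply: measurable_funM.
      apply: measurable_funM.
        by apply: measurable_funB; [exact: mu|apply: mr; exact: ltnW].
      apply: measurable_fun_ifT => //; apply: measurable_fun_ler => //.
      by apply: measurableT_comp => //; exact: mu.
    by apply: mk; exact: ltnW.
  - move=> n j s t st; apply: measurable_funM => //.
    exact: (measurable_fun_mono (sF s) (ndF st) (mV s)).
  - move=> n j t n0n; apply: cond_dominated_residual => //.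
    + exact: CM.
    + exact: M0.
    + exact: mk.
    + by move=> E; exact: VZ.
have dev1 := deviation 1 (normr1 _).
have dev2 := deviation (-1) (normrN1 _).
near=> w.
have [C1 HC1] : exists C, forall n j,
    (n0 <= n)%N -> (2 <= n)%N -> (j < n ^ 4)%N ->
    \sum_(t < n) (1 * ((u t w - r t w) * I n t w * k n j t w) -
        2 * M n `^ (- tau) * V t w) <=
      C * (2 * M n * Num.sqrt (n%:R * ln n%:R)).
  by near: w; exact: dev1.
have [C2 HC2] : exists C, forall n j,
    (n0 <= n)%N -> (2 <= n)%N -> (j < n ^ 4)%N ->
    \sum_(t < n) (-1 * ((u t w - r t w) * I n t w * k n j t w) -
        2 * M n `^ (- tau) * V t w) <=
      C * (2 * M n * Num.sqrt (n%:R * ln n%:R)).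
  by near: w; exact: dev2.
have [CZ [CZ0 HCZ]] : exists C, 0 <= C /\
     forall n, \sum_(i < n) Z i w <= C * n%:R `^ (1 + eps).
  by near: w; exact: growthZ.
have [CV [CV0 HCV]] : exists C, 0 <= C /\
     forall n, \sum_(i < n) V i w <= C * n%:R `^ (1 + eps).
  by near: w; exact: growthV.
exists (2 * (`|C1| + `|C2| + CV + CZ)); split; first by rewrite mulr_ge0// !addr_ge0.
move=> n j n0n n2 jn; rewrite -/(c n j).
set e1 := M n * Num.sqrt (n%:R * ln n%:R).
set e2 := M n `^ (- tau) * n%:R `^ (1 + eps).
have e10 : 0 <= e1 by rewrite mulr_ge0// ltW// M0.
have e20 : 0 <= e2 by rewrite mulr_ge0// powR_ge0.
pose S1 := \sum_(t < n) (u t w - r t w) * I n t w * k n j t w.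
pose S2 := \sum_(t < n) (u t w - r t w) * (1 - I n t w) * k n j t w.
have -> : \sum_(t < n) (u t w - r t w) * nkernel (h n) (c n j) (x t w) = S1 + S2.
  by rewrite /S1 /S2 -big_split; apply: eq_bigr => t _ /=; rewrite /k; ring.
have sumV : \sum_(t < n) (2 * M n `^ (- tau) * V t w) <= 2 * CV * e2.
  rewrite -mulr_sumr -!mulrA ler_pM2l// mulrCA ler_wpM2l ?powR_ge0//.
have C1e : C1 * (2 * M n * Num.sqrt (n%:R * ln n%:R)) <= 2 * `|C1| * e1.
  by rewrite -mulrA -/e1; have := ler_wpM2r e10 (ler_norm C1); lra.
have C2e : C2 * (2 * M n * Num.sqrt (n%:R * ln n%:R)) <= 2 * `|C2| * e1.
  by rewrite -mulrA -/e1; have := ler_wpM2r e10 (ler_norm C2); lra.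
have S1ub : S1 <= 2 * `|C1| * e1 + 2 * CV * e2.
  have := HC1 n j n0n n2 jn; rewrite sumrB -mulr_sumr -/S1; lra.
have S1lb : - S1 <= 2 * `|C2| * e1 + 2 * CV * e2.
  have := HC2 n j n0n n2 jn; rewrite sumrB -mulr_sumr -/S1; lra.
have S2b : `|S2| <= 2 * CZ * e2.
  apply: le_trans (ler_norm_sum _ _ _) _.
  apply: (@le_trans _ _ (\sum_(t < n) 2 * M n `^ (- tau) * Z t w)); last first.
    by rewrite -mulr_sumr -!mulrA ler_pM2l// mulrCA ler_wpM2l ?powR_ge0.
  apply: ler_sum => t _.
  have /andP[kge0 kle1] := k01 n j t w.
  rewrite 2!normrM (ger0_norm kge0) /I; case: ifPn => uM.
    by rewrite subrr normr0 mulr0 mul0r !mulr_ge0// powR_ge0.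
  rewrite subr0 normr1 mulr1; apply: (@le_trans _ _ `|u t w - r t w|).
    by rewrite ler_piMr.
  move: uM; rewrite -ltNge => uM.
  have H1 : 2 * `|u t w| <= 2 * M n `^ (- tau) * Z t w.
    by rewrite -mulrA ler_pM2l// powR_tail// M0.
  apply: le_trans (ler_normB _ _) _.
  by have := r_bounded t w; have := CM n0n; lra.
have p1 := mulr_ge0 (normr_ge0 C1) e10; have p2 := mulr_ge0 (normr_ge0 C2) e10.
have p3 := mulr_ge0 (normr_ge0 C1) e20; have p4 := mulr_ge0 (normr_ge0 C2) e20.
have p5 := mulr_ge0 CV0 e10; have p6 := mulr_ge0 CZ0 e10.
have p7 := mulr_ge0 CV0 e20; have p8 := mulr_ge0 CZ0 e20.
have S1b : `|S1| <= 2 * (`|C1| + `|C2|) * e1 + 2 * CV * e2.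
  by rewrite ler_norml; apply/andP; split; lra.
by apply: le_trans (ler_normD _ _) _; lra.
Unshelve. all: by end_near. Qed.

End numerator.

(** * Occupation counts *)

Section conditional_density.
Context d (T : measurableType d) (R : realType) (P : probability T R).

(** Almost sure uniqueness holds among [G]-measurable functions, so the comparison takes place under
    the restriction of [P] to [G], whose null sets are [P]-null. *)
Lemma cond_exp_cst1_ae (G : set (set T)) (V : T -> \bar R) :
  sigma_algebra setT G -> G `<=` measurable -> (forall w, (0 <= V w)%E) ->
  is_cond_exp P G (fun=> 1%:E) V -> {ae P, forall w, V w = 1%E}.
Proof.
move=> sG subG V0 [_ mV iV VE].
pose TG := g_sigma_algebraType G.
have mG (B : set TG) : measurable B -> measurable (B : set T).
  by rewrite measurable_subE => // /subG.
have mid : measurable_fun setT (id : T -> TG).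
  by move=> _ B mB; rewrite setTI; exact: mG.
pose mu0 : {measure set TG -> \bar R} := pushforward P (id : T -> TG).
pose mu1 := mu0 mid.
have intE (U : TG -> \bar R) E : measurable_fun setT U -> (forall w, (0 <= U w)%E) ->
    measurable E -> (\int[mu1]_(w in E) U w = \int[P]_(w in E) U w)%E.
  move=> mU U0 mE; rewrite /mu1 /mu0 /= ge0_integral_pushforward//.
  exact: measurable_funTS.
have : ae_eq mu1 setT (V : TG -> \bar R) (cst 1%E).
  apply: integral_ae_eq => //.
  - apply/integrableP; split => //.
    under eq_integral do rewrite gee0_abs//.
    rewrite intE//.
    by have := integrable_lty measurableT iV.
  - move=> E _ mE; rewrite !intE//; apply: VE.
    by rewrite measurable_subE in mE.
case=> N [mN N0 VN]; exists N; split; first exact: mG.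
  exact: N0.
by move=> w /= nV; apply: VN => /= H; apply: nV; exact: H.
Qed.

Variable H : nat -> set (set T).
Hypothesis sH : forall t, sigma_algebra setT (H t).
Hypothesis subH : forall t, H t `<=` measurable.
Hypothesis ndH : forall s t, (s <= t)%N -> H s `<=` H t.
Variables (x : nat -> T -> R) (g : nat -> T -> R -> R).
Hypothesis mx : forall s t, (s < t)%N ->
  measurable_fun setT (x s : g_sigma_algebraType (H t) -> R).
Hypothesis g_density : forall t, is_cond_density P (H t) (x t) (g t).

Let p (I : set R) t w := fine (\int[lebesgue_measure]_(y in I) (g t w y)%:E)%E.

Lemma ae_cond_density_mass :
  {ae P, forall w, forall t, (\int[lebesgue_measure]_y (g t w y)%:E = 1)%E}.
Proof.
apply: ae_foralln => t; have [g0 mg gA] := g_density t.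
apply: (cond_exp_cst1_ae (sH t) (@subH t)).
  by move=> w; apply: integral_ge0 => y _; rewrite lee_fin.
have := gA setT measurableT.
by under eq_fun do rewrite indicT.
Qed.

(** A lower bound on visits is an upper bound on visits to the complement: the indicators [1 - \1_I]
    are bounded by 1 and compensated by [1 - Num.min 1 p]. *)
Lemma ae_counting (I : nat -> nat -> set R) :
  (forall n j, measurable (I n j)) ->
  {ae P, forall w, exists C, forall n j, (2 <= n)%N -> (j < n ^ 4)%N ->
    \sum_(t < n) (Num.min 1 (p (I n j) t w) - \1_(I n j) (x t w)) <=
    C * Num.sqrt (n%:R * ln n%:R)}.
Proof.
move=> mI.
have p0 J t w : 0 <= p J t w.
  have [g0 _ _] := g_density t.
  by rewrite /p fine_ge0// integral_ge0// => y _; rewrite lee_fin.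
have mp J s t : measurable J -> (s <= t)%N ->
    measurable_fun setT (p J s : g_sigma_algebraType (H t) -> R).
  move=> mJ st; apply: (measurable_fun_mono (sH s) (ndH st)).
  have [_ _ /(_ J mJ)[_ mV _ _]] := g_density s.
  by apply: (measurableT_comp _ mV); exact: fine_measurable.
have m1 J s t : measurable J -> (s < t)%N ->
    measurable_fun setT ((fun w => \1_J (x s w)) : g_sigma_algebraType (H t) -> R).
  move=> mJ st; apply: (@measurableT_comp _ _ _ _ _ _ (\1_J : R -> R)) => //.
  exact: mx.
have := @ae_uniform_deviation _ _ _ P H
  (fun n j t w => 1 - \1_(I n j) (x t w))
  (fun n j t w => 1 - Num.min 1 (p (I n j) t w)) (fun=> 1) 0 sH subH.
have -> : {ae P, forall w, exists C, forall n j, (2 <= n)%N -> (j < n ^ 4)%N ->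
    \sum_(t < n) (Num.min 1 (p (I n j) t w) - \1_(I n j) (x t w)) <=
    C * Num.sqrt (n%:R * ln n%:R)} =
  {ae P, forall w, exists C, forall n j, (0 <= n)%N -> (2 <= n)%N -> (j < n ^ 4)%N ->
    \sum_(t < n) (1 - \1_(I n j) (x t w) - (1 - Num.min 1 (p (I n j) t w))) <=
    C * (1 * Num.sqrt (n%:R * ln n%:R))}.
  congr (almost_everywhere _ _); apply/funext => w; apply/propext; split.
    move=> [C HC]; exists C => n j _ n2 jn; rewrite mul1r; apply: le_trans (HC n j n2 jn).
    by apply: ler_sum => t _; lra.
  move=> [C HC]; exists C => n j n2 jn; rewrite -(mul1r (Num.sqrt _)).
  apply: le_trans (HC n j (leq0n _) n2 jn).
  by apply: ler_sum => t _; lra.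
apply=> //.
- move=> n j t w _; rewrite indicE; case: (_ \in _); rewrite ?subrr ?normr0// subr0 normr1.
  by [].
- by move=> n j t w; rewrite subr_ge0 ge_min lexx.
- by move=> n j s t st; apply: measurable_funB => //; exact: m1.
- move=> n j s t st; apply: measurable_funB => //; apply: measurable_minr => //.
  exact: mp.
- move=> n j t _; apply: (cond_dominated_indicator (sH t) (@subH t)).
  + exact: (measurable_fun_sub (sH t.+1) (@subH t.+1) (m1 _ _ _ (mI n j) (ltnSn t))).
  + by move=> w; rewrite indicE; case: (_ \in _); rewrite ?lexx ler01.
  + exact: mp.
  + by [].
  + move=> E HE; have [_ _ /(_ _ (mI n j))[_ _ iV VE]] := g_density t.
    rewrite -VE//; apply: ae_eq_integral => //.
    * exact: (@subH t).
    * apply/measurable_EFinP; apply: measurable_funTS.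
      exact: (measurable_fun_sub (sH t) (@subH t) (mp _ _ _ (mI n j) (leqnn t))).
    * exact: measurable_funTS (measurable_int _ iV).
    (* [p] is the finite part of the conditional mass, which is integrable and hence finite almost
       surely. *)
    * have := integrable_ae measurableT iV.
      by apply: filterS => w /(_ Logic.I) Vfin _; rewrite /p fineK.
Qed.

End conditional_density.

(** * The Gamma function and the estimator *)

Section gamma_function.
Context (R : realType).

Let gamma_integrand (s t : R) : R := t `^ s * expR (- t).

Let gamma_integrand_ge0 s t : 0 <= gamma_integrand s t.
Proof. by rewrite mulr_ge0 ?powR_ge0 ?expR_ge0. Qed.

Let measurable_gamma_integrand s : measurable_fun setT (gamma_integrand s).
Proof.
apply: measurable_funM; first exact: measurable_powR.
by apply: measurableT_comp.
Qed.

Let measurable_EFin_gamma_integrand s D :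
  measurable_fun D (EFin \o gamma_integrand s).
Proof.
by apply: measurable_funTS; apply/measurable_EFinP; exact: measurable_gamma_integrand.
Qed.

(* [ln t <= t / c - 1 + ln c] at [c = 2 * s]. *)
Let gamma_integrand_le s t : 0 < s -> 0 < t ->
  gamma_integrand s t <= 2 * expR (s * ln (2 * s)) * exponential_pdf (1 / 2) t.
Proof.
move=> s0 t0; rewrite exponential_pdfE ?(ltW t0)// /gamma_integrand /powR gt_eqF//.
rewrite -expRD.
have -> : 2 * expR (s * ln (2 * s)) * (1 / 2 * expR (- (1 / 2) * t)) =
  expR (s * ln (2 * s)) * expR (- (1 / 2) * t) by field.
rewrite -expRD ler_expR.
have s20 : 0 < 2 * s by rewrite mulr_gt0.
have := ln_leB1 (divr_gt0 t0 s20); rewrite ln_div ?posrE// => H.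
have := ler_wpM2l (ltW s0) H.
have -> : s * (t / (2 * s) - 1) = t / 2 - s by field; rewrite gt_eqF.
lra.
Qed.

(** A real-valued integral is 0 by default when it diverges, so finiteness is needed besides
    positivity: the integrand is at least [expR (- 2)] on [[1, 2]] and at most a multiple of the
    exponential density of rate [1 / 2]. *)
Lemma Gamma_gt0 (s : R) : 0 < s -> 0 < Gamma (s + 1).
Proof.
move=> s0; rewrite /Gamma addrK /Rintegral.
change (0 < fine (\int[lebesgue_measure]_(t in `]0%R, +oo[) (gamma_integrand s t)%:E)%E).
apply: fine_gt0; apply/andP; split.
- apply: (@lt_le_trans _ _
    (\int[lebesgue_measure]_(t in `[1%R, 2%R]) (expR (- 2))%:E)%E).
    rewrite integral_cst//= lebesgue_measure_itv/= lte_fin ltr1n -EFinD -EFinM lte_fin.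
    by rewrite mulr_gt0 ?expR_gt0//; lra.
  apply: (@le_trans _ _
    (\int[lebesgue_measure]_(t in `[1%R, 2%R]) (gamma_integrand s t)%:E)%E).
    apply: ge0_le_integral => //.
    - exact: measurable_EFin_gamma_integrand.
    - move=> t /=; rewrite in_itv/= lee_fin => /andP[t1 t2].
      rewrite /gamma_integrand -[leLHS]mul1r; apply: ler_pM => //.
        apply: (@le_trans _ _ (1 `^ s)); first by rewrite powR1.
        by rewrite ge0_ler_powR ?nnegrE ?(ltW s0)//; lra.
      by rewrite ler_expR lerN2.
  apply: ge0_subset_integral => //.
  - exact: measurable_EFin_gamma_integrand.
  - by move=> t _; rewrite lee_fin.
  - by move=> t /=; rewrite !in_itv/= andbT => /andP[t1 _]; lra.
- apply: (@le_lt_trans _ _ (\int[lebesgue_measure]_(t in `]0%R, +oo[)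
     ((2 * expR (s * ln (2 * s)))%:E * (exponential_pdf (1 / 2) t)%:E))%E).
    apply: ge0_le_integral => //.
    - by move=> t _; rewrite lee_fin.
    - exact: measurable_EFin_gamma_integrand.
    - apply: measurable_funTS; apply: measurable_funeM; apply/measurable_EFinP.
      exact: measurable_exponential_pdf.
    - move=> t /=; rewrite in_itv/= andbT => t0; rewrite -EFinM lee_fin.
      exact: gamma_integrand_le.
  rewrite ge0_integralZl_EFin//; last 2 first.
  - by move=> t _; rewrite lee_fin exponential_pdf_ge0//; lra.
  - apply: measurable_funTS; apply/measurable_EFinP.
    exact: measurable_exponential_pdf.
  apply: (@le_lt_trans _ _ ((2 * expR (s * ln (2 * s)))%:E * 1)%E); last first.
    by rewrite mule1 ltry.
  rewrite lee_wpmul2l ?lee_fin ?mulr_ge0 ?expR_ge0//.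
  rewrite -(@integral_exponential_pdf _ (1 / 2 : R)); last lra.
  apply: ge0_subset_integral => //.
  - by apply/measurable_EFinP; exact: measurable_exponential_pdf.
  - by move=> t _; rewrite lee_fin exponential_pdf_ge0//; lra.
Qed.

Lemma gamma_kernel_proportional (h : nat -> R) n (x : R) : 0 < h n -> 0 < x ->
  exists2 kappa, 0 < kappa &
    forall y, 0 <= y -> gamma_kernel h n x y = kappa * nkernel (h n) x y.
Proof.
move=> h0 x0; have s0 : 0 < x / h n by rewrite divr_gt0.
(* The value of the gamma kernel at [y = x]. *)
exists ((Gamma (x / h n + 1) * h n `^ (x / h n + 1))^-1 *
    (x `^ (x / h n) * expR (- (x / h n)))).
  by rewrite mulr_gt0 ?invr_gt0 ?mulr_gt0 ?Gamma_gt0 ?powR_gt0 ?expR_gt0.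
move=> y y0; rewrite /gamma_kernel /gamma_density /nkernel addrK indicE mem_set; last first.
  by rewrite /= in_itv/= y0.
rewrite mulr1.
have px := gt_eqF (powR_gt0 (x / h n) x0).
have e0 := gt_eqF (expR_gt0 (- (x / h n))).
have g0 := gt_eqF (Gamma_gt0 s0).
have p0 := gt_eqF (powR_gt0 (x / h n + 1) h0).
by field; rewrite px e0 g0 p0.
Qed.

(** The common factor [kappa] cancels even if the denominator vanishes, since inversion is
    multiplicative with [0^-1 = 0]. The sum now runs over [t < n], index [t] standing for time
    [t + 1]. *)
Lemma gamma_regression_estimatorE (T : Type) (h : nat -> R) (Phi : R -> R)
    (X Y : int -> T -> R) n w x : 0 < h n -> 0 < x -> (forall t, 0 <= X t w) ->
  gamma_regression_estimator h Phi X Y n w x =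
  (\sum_(t < n) Phi (Y (t.+1)%:Z w) * nkernel (h n) x (X (t.+1)%:Z w)) /
  (\sum_(t < n) nkernel (h n) x (X (t.+1)%:Z w)).
Proof.
move=> h0 x0 X0; have [kappa kappa0 kE] := gamma_kernel_proportional h0 x0.
rewrite /gamma_regression_estimator !big_add1 !big_mkord /=.
under eq_bigr do rewrite kE// mulrCA.
under [X in _ / X]eq_bigr do rewrite kE//.
rewrite -!mulr_sumr invfM mulrACA divff ?gt_eqF// mul1r //.
Qed.

End gamma_function.

(** Only [x] is confined to the compact segment while [y] may leave it. As [0 < a], continuity
    within the half-line is plain continuity at each such [x], and compactness makes [delta]
    uniform. *)
Lemma uniform_continuity_segment (R : realType) (r : R -> R) (a b e : R) :
  0 < a -> {within `[0, +oo[, continuous r} -> 0 < e ->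
  exists2 delta, 0 < delta &
    forall x y, a <= x <= b -> 0 <= y -> `|y - x| < delta -> `|r y - r x| <= e.
Proof.
move=> a0 cr e0.
have cr' x : 0 < x -> {for x, continuous r}.
  move=> x0; have : {within `]0, +oo[, continuous r}.
    apply: continuous_subspaceW cr => z /=.
    by rewrite !in_itv/= !andbT => /ltW.
  rewrite continuous_open_subspace; last exact: interval_open.
  by apply; rewrite inE /= in_itv/= x0.
have /compact_near_coveringP nc := @segment_compact R a b.
pose Pr (delta : R) x := forall y, 0 <= y -> `|y - x| < delta -> `|r y - r x| <= e.
have [delta [delta0 Hd]] : exists delta, 0 < delta /\ `[a, b] `<=` Pr delta.
  have : \forall delta \near 0^'+, `[a, b] `<=` Pr delta.
    apply: nc => x /=; rewrite in_itv/= => /andP[ax xb].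
    have x0 : 0 < x by lra.
    have /cvgrPdist_lt/(_ (e / 2)) := cr' x x0.
    have e2 : 0 < e / 2 by lra.
    move=> /(_ e2) /nbhs_ballP[rho /= rho0 Hrho].
    (* Moving the centre from [x] to [x'] and then from [x'] to [y] costs [rho / 2] each. *)
    exists (ball x (rho / 2), [set t : R | t < rho / 2]) => /=.
      split; first by apply: nbhsx_ballx; lra.
      by apply: nbhs_right_lt; lra.
    move=> [x' t] /= [xx' t2] y y0 yx'.
    have H1 : `|r x - r x'| < e / 2.
      by apply: Hrho; rewrite /ball /= in xx' *; lra.
    have H2 : `|r x - r y| < e / 2.
      apply: Hrho; rewrite /ball /= in xx' *.
      have := ler_normD (x - x') (x' - y); rewrite addrA subrK (distrC x' y); lra.
    have -> : r y - r x' = (r x - r x') - (r x - r y) by lra.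
    by apply: le_trans (ler_normB _ _) _; lra.
  move=> H.
  near (0 : R)^'+ => delta; exists delta; split.
    by near: delta; exact: nbhs_right_gt.
  by near: delta; exact: H.
by exists delta => // x y xab; apply: Hd; rewrite /= in_itv.
Unshelve. all: by end_near. Qed.

(** * Convergence along one trajectory *)

Section rates.
Variables (R : realType) (h : nat -> R) (tau theta : R).
Hypothesis h_gt0 : forall n, 0 < h n.
Hypotheses (tau0 : 0 < tau) (theta_itv : 0 < theta < tau / (tau + 1)).
Hypothesis h_rate : n%:R `^ theta * h n / ln n%:R @[n --> \oo] --> +oo.

Lemma rate_ge (K : R) : 0 < K ->
  \forall n \near \oo, [/\ 1 <= n%:R :> R, 1 <= ln n%:R :> R & K * ln n%:R <= n%:R `^ theta * h n].
Proof.
move=> K0; near=> n.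
have n1 : 1 <= n%:R :> R by near: n; exact: nbhs_infty_ger.
have l1 : 1 <= ln n%:R :> R.
  rewrite -[leLHS]expRK ler_ln ?posrE ?expR_gt0//; last by rewrite (lt_le_trans _ n1).
  by near: n; exact: nbhs_infty_ger.
split => //; rewrite -ler_pdivlMr; last by rewrite (lt_le_trans _ l1).
by near: n; move/cvgryPge : h_rate; apply.
Unshelve. all: by end_near. Qed.

Lemma theta_lt1 : theta < 1.
Proof.
case/andP: theta_itv => _ /lt_le_trans; apply.
by rewrite ler_pdivrMr ?mul1r ?lerDl// addr_gt0.
Qed.

Lemma rate_nh : \forall n \near \oo, 1 <= n%:R * h n.
Proof.
near=> n.
have [n1 l1 H] : [/\ 1 <= n%:R :> R, 1 <= ln n%:R :> R & 1 * ln n%:R <= n%:R `^ theta * h n].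
  by near: n; exact: rate_ge.
rewrite mul1r in H; apply: le_trans l1 _; apply: le_trans H _.
rewrite ler_pM2r//; apply: ler1_powR => //; exact: ltW theta_lt1.
Unshelve. all: by end_near. Qed.

Lemma powR_sqr (x p : R) : (x `^ p) ^+ 2 = x `^ (2 * p).
Proof. by rewrite mulrC powRrM powR_mulrn// powR_ge0. Qed.

Lemma rate_deviation (e : R) : 0 < e -> \forall n \near \oo,
  n%:R `^ ((1 - theta) / 2) * Num.sqrt (n%:R * ln n%:R) <= e * (n%:R * Num.sqrt (h n)).
Proof.
move=> e0; near=> n.
have [n1 l1 H] : [/\ 1 <= n%:R :> R, 1 <= ln n%:R :> R &
    (e ^+ 2)^-1 * ln n%:R <= n%:R `^ theta * h n].
  by near: n; apply: rate_ge; rewrite invr_gt0 exprn_gt0.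
have n0 : 0 < n%:R :> R by rewrite (lt_le_trans _ n1).
have p0 : 0 < n%:R `^ theta :> R by rewrite powR_gt0.
rewrite -ler_sqr ?nnegrE; last 2 first.
- by rewrite mulr_ge0 ?powR_ge0.
- by rewrite !mulr_ge0// ltW.
rewrite !exprMn powR_sqr !sqr_sqrtr ?(ltW (h_gt0 n))//; last first.
  by rewrite mulr_ge0 ?(ltW n0)// (le_trans _ l1).
have -> : 2 * ((1 - theta) / 2) = 1 - theta by lra.
rewrite powRB ?powRr1 ?(ltW n0)//; last by rewrite (gt_eqF n0) implybT.
rewrite ler_pdivrMl ?exprn_gt0// in H.
have -> : n%:R / n%:R `^ theta * (n%:R * ln n%:R) =
  n%:R ^+ 2 * (ln n%:R / n%:R `^ theta) :> R by ring.
rewrite mulrCA ler_wpM2l ?sqr_ge0// ler_pdivrMr//; lra.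
Unshelve. all: by end_near. Qed.

(** The two powers multiply to [n]^ (1 - theta / 2)[; after squaring,]1 <= ln n <= e ^+ 2 * n
    [^ theta * h n] suffices. *)
Lemma rate_tail (e : R) : 0 < e -> \forall n \near \oo,
  (n%:R `^ ((1 - theta) / 2)) `^ (- tau) *
    n%:R `^ (1 + (tau * (1 - theta) - theta) / 2) <= e * (n%:R * Num.sqrt (h n)).
Proof.
move=> e0; near=> n.
have [n1 l1 H] : [/\ 1 <= n%:R :> R, 1 <= ln n%:R :> R &
    (e ^+ 2)^-1 * ln n%:R <= n%:R `^ theta * h n].
  by near: n; apply: rate_ge; rewrite invr_gt0 exprn_gt0.
have n0 : 0 < n%:R :> R by rewrite (lt_le_trans _ n1).
have nn0 : n%:R != 0 :> R by rewrite gt_eqF.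
have p0 : 0 < n%:R `^ theta :> R by rewrite powR_gt0.
rewrite -powRrM -powRD; last by rewrite nn0 implybT.
rewrite -ler_sqr ?nnegrE ?powR_ge0//; last by rewrite !mulr_ge0// ltW.
rewrite powR_sqr !exprMn sqr_sqrtr ?(ltW (h_gt0 n))//.
have -> : 2 * ((1 - theta) / 2 * - tau + (1 + (tau * (1 - theta) - theta) / 2)) =
  2%:R - theta by lra.
rewrite powRB; last by rewrite nn0 implybT.
rewrite powR_mulrn ?(ltW n0)// mulrCA ler_wpM2l ?sqr_ge0//.
rewrite ler_pdivrMl ?exprn_gt0// in H.
rewrite -[leLHS]mul1r ler_pdivrMr//; lra.
Unshelve. all: by end_near. Qed.

End rates.

Lemma grid_point (R : realType) (a delta x : R) (N : nat) : (0 < N)%N ->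
  a <= x -> x <= a + N%:R * delta ->
  exists2 j, (j < N)%N & a + j%:R * delta <= x <= a + j%:R * delta + delta.
Proof.
elim: N => // -[|N] IH _ ax xb.
  by exists 0%N => //; rewrite mul0r addr0 ax/=; move: xb; rewrite mul1r.
have [xN|Nx] := leP x (a + N.+1%:R * delta).
  by have [j jN jx] := IH isT ax xN; exists j => //; exact: ltnW.
exists N.+1 => //; rewrite (ltW Nx)/=.
by move: xb; rewrite -[N.+2%:R]natr1 mulrDl mul1r addrA.
Qed.

(** * Deterministic estimates for a fixed outcome *)

Section pathwise.
Variables (R : realType) (h : nat -> R) (a b : R).
Hypothesis h_gt0 : forall n, 0 < h n.
Hypothesis h_cvg0 : h n @[n --> \oo] --> (0 : R).
Hypothesis nh1 : \forall n \near \oo, 1 <= n%:R * h n.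
Hypotheses (a_gt0 : 0 < a) (a_lt_b : a < b).

(** The order of the number of visits to a window of width [Num.sqrt (h n)]; every error is measured
    against it. *)
Let q n := n%:R * Num.sqrt (h n).
Let mesh (n : nat) : R := (b - a) / n%:R ^+ 4.
Let c (n j : nat) : R := a + j%:R * mesh n.

Lemma bandwidth_lt (e : R) : 0 < e -> \forall n \near \oo, h n < e.
Proof.
move=> e0; move/cvgr0Pnorm_lt : h_cvg0 => /(_ e e0).
by apply: filterS => n; rewrite gtr0_norm.
Qed.

Lemma sqrt_bandwidth_lt (e : R) : 0 < e -> \forall n \near \oo, Num.sqrt (h n) < e.
Proof.
move=> e0; have := bandwidth_lt (exprn_gt0 2 e0).
apply: filterS => n H; rewrite -ltr_sqr ?nnegrE ?(ltW e0)//.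
by rewrite sqr_sqrtr// ltW.
Qed.

Lemma q_ge1 : \forall n \near \oo, 1 <= q n.
Proof.
near=> n.
have H : 1 <= n%:R * h n by near: n; exact: nh1.
have n1 : 1 <= n%:R :> R by near: n; exact: nbhs_infty_ger.
rewrite /q -ler_sqr ?nnegrE//.
by rewrite expr1n exprMn sqr_sqrtr ?(ltW (h_gt0 n))// -[leLHS]mulr1 expr2 -mulrA ler_pM.
Unshelve. all: by end_near. Qed.

(** The cube is the total cost of leaving the grid: [n] from [1 / h n], and [n ^ 2] from the growth
    of the sum of the absolute residuals. *)
Lemma mesh_le (e : R) : 0 < e -> \forall n \near \oo, n%:R ^+ 3 * mesh n <= e.
Proof.
move=> e0; near=> n.
have n1 : 1 <= n%:R :> R by near: n; exact: nbhs_infty_ger.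
have H : (b - a) / e <= n%:R by near: n; exact: nbhs_infty_ger.
have n0 : 0 < n%:R :> R by rewrite (lt_le_trans _ n1).
have -> : n%:R ^+ 3 * mesh n = (b - a) / n%:R by rewrite /mesh; field; rewrite gt_eqF.
by rewrite ler_pdivrMr// mulrC -ler_pdivrMr.
Unshelve. all: by end_near. Qed.

Lemma mesh_le_bandwidth : \forall n \near \oo, mesh n <= Num.sqrt (h n) / 2.
Proof.
near=> n.
have n1 : 1 <= n%:R :> R by near: n; exact: nbhs_infty_ger.
have n0 : 0 < n%:R :> R by rewrite (lt_le_trans _ n1).
have q1 : 1 <= q n by near: n; exact: q_ge1.
have m1 : n%:R ^+ 3 * mesh n <= 1 / 2 by near: n; apply: mesh_le.
rewrite -(ler_pM2l n0); apply: le_trans (_ : 1 / 2 <= _); last by rewrite mulrA ler_wpM2r.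
apply: le_trans m1; rewrite ler_wpM2r//.
  by rewrite divr_ge0// subr_ge0 ltW.
by rewrite -[leLHS]expr1 ler_weXn2l.
Unshelve. all: by end_near. Qed.

Variables (xs : nat -> R) (gs : nat -> R -> R) (f : R -> R) (C3 m delta0 : R).
Hypothesis xs_ge0 : forall t, 0 <= xs t.
Hypothesis mgs : forall t, measurable_fun setT (gs t).
Hypothesis gs_ge0 : forall t y, 0 <= gs t y.
Hypothesis gs_mass : forall t, (\int[lebesgue_measure]_y (gs t y)%:E = 1)%E.

Let p (I : set R) t := fine (\int[lebesgue_measure]_(y in I) (gs t y)%:E)%E.

(** Total mass 1 makes the cap inactive, so the sum is the integral over the interval of the summed
    densities. *)
Lemma sum_mass_ge (n : nat) (v l L : R) : 0 <= l -> 0 <= L ->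
  (forall y, v <= y <= v + l -> L <= \sum_(t < n) gs t y) ->
  L * l <= \sum_(t < n) Num.min 1 (p `[v, v + l] t).
Proof.
move=> l0 L0 HL; set I := `[v, v + l]%classic.
have mgE D t : measurable_fun D (EFin \o gs t).
  by apply: measurable_funTS; apply/measurable_EFinP; exact: mgs.
have mI : measurable I by exact: measurable_itv.
have le1 t : (\int[lebesgue_measure]_(y in I) (gs t y)%:E <= 1)%E.
  rewrite -(gs_mass t); apply: ge0_subset_integral => //.
  - exact: mgE.
  - by move=> y _; rewrite lee_fin.
have ge0 t : (0 <= \int[lebesgue_measure]_(y in I) (gs t y)%:E)%E.
  by apply: integral_ge0 => y _; rewrite lee_fin.
have fin t : (\int[lebesgue_measure]_(y in I) (gs t y)%:E)%E \is a fin_num.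
  by rewrite ge0_fin_numE// (le_lt_trans (le1 t))// ltry.
have -> : \sum_(t < n) Num.min 1 (p I t) = \sum_(t < n) p I t.
  by apply: eq_bigr => t _; rewrite min_r// -lee_fin fineK.
rewrite -lee_fin -sumEFin.
under eq_bigr do rewrite fineK//.
rewrite -ge0_integral_sum//; last first.
- by move=> t y _; rewrite lee_fin.
- by move=> t; exact: mgE.
apply: (@le_trans _ _ (\int[lebesgue_measure]_(y in I) L%:E)%E).
  rewrite integral_cst//= lebesgue_measure_itv/= lte_fin.
  case: ifPn => [_|]; first by rewrite -EFinD -EFinM lee_fin addrAC subrr add0r.
  rewrite -leNgt gerDl => l0'; rewrite mule0 lee_fin.
  by rewrite mulr_ge0_le0.
apply: ge0_le_integral => //.
- by apply: emeasurable_sum => t; exact: mgE.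
- move=> y; rewrite /I /= in_itv/= => yI; rewrite sumEFin lee_fin; exact: HL.
Qed.

Hypothesis favg : forall e, 0 < e ->
  \forall n \near \oo, forall y, `|n%:R^-1 * (\sum_(t < n) gs t y) - f y| <= e.
Hypotheses (m0 : 0 < m) (delta0_gt0 : 0 < delta0).
Hypothesis f_ge : forall y, a <= y <= b + delta0 -> m <= f y.
Hypothesis counting : forall n j, (2 <= n)%N -> (j < n ^ 4)%N ->
  \sum_(t < n) (Num.min 1 (p `[c n j, c n j + Num.sqrt (h n) / 2] t) -
     \1_`[c n j, c n j + Num.sqrt (h n) / 2] (xs t)) <=
  C3 * Num.sqrt (n%:R * ln n%:R).
Hypothesis counting_rate : forall e, 0 < e ->
  \forall n \near \oo, Num.sqrt (n%:R * ln n%:R) <= e * q n.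

Lemma grid_near n x : (0 < n)%N -> a <= x <= b ->
  exists2 j, (j < n ^ 4)%N & c n j <= x <= c n j + mesh n.
Proof.
move=> n0 /andP[ax xb]; apply: grid_point => //; first by rewrite expn_gt0 n0.
suff -> : (n ^ 4)%:R * mesh n = b - a by rewrite addrCA subrr addr0.
by rewrite /mesh natrX mulrCA divff ?mulr1// expf_neq0// pnatr_eq0 -lt0n.
Qed.

(** Counts are controlled only on intervals starting at grid points. The grid point below [x] is
    within [mesh n], at most half of [Num.sqrt (h n)], so its interval lies in the window around [x]
    where the kernel is at least [expR (- (2 / a))]. *)
Lemma denominator_ge : exists2 c0, 0 < c0 &
  \forall n \near \oo, forall x, a <= x <= b ->
    c0 * q n <= \sum_(t < n) nkernel (h n) x (xs t).
Proof.
(* Averaged densities at least [m / 2] over a length [Num.sqrt (h n) / 2] give mass [m / 4 * q n];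
   half of it is spent on the counting error. *)
exists (expR (- (2 / a)) * (m / 8)); first by rewrite mulr_gt0 ?expR_gt0 ?divr_gt0.
pose e := m / 8 / (`|C3| + 1).
have C31 : 0 < `|C3| + 1 by rewrite ltr_wpDl.
have e0 : 0 < e by rewrite /e !divr_gt0.
near=> n => x xab.
have n2 : (2 <= n)%N by near: n; exact: nbhs_infty_ge.
have n0 : (0 < n)%N by exact: ltnW.
have nR0 : 0 < n%:R :> R by rewrite ltr0n.
have avg : forall y, `|n%:R^-1 * (\sum_(t < n) gs t y) - f y| <= m / 2.
  by near: n; apply: favg; rewrite divr_gt0.
have ms : mesh n <= Num.sqrt (h n) / 2 by near: n; exact: mesh_le_bandwidth.
have sa : Num.sqrt (h n) < a / 2 by near: n; apply: sqrt_bandwidth_lt; rewrite divr_gt0.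
have sd : Num.sqrt (h n) < delta0 by near: n; exact: sqrt_bandwidth_lt.
have rate : Num.sqrt (n%:R * ln n%:R) <= e * q n by near: n; exact: counting_rate.
have [j jn /andP[cx xc]] := grid_near n0 xab.
have /andP[ax xb] := xab.
set s := Num.sqrt (h n) in ms sa sd *.
have s0 : 0 < s by rewrite sqrtr_gt0.
set I := `[c n j, c n j + s / 2]%classic.
have ac : a <= c n j.
  by rewrite lerDl mulr_ge0// divr_ge0 ?exprn_ge0// subr_ge0 ltW.
have massI : n%:R * (m / 2) * (s / 2) <= \sum_(t < n) Num.min 1 (p I t).
  apply: sum_mass_ge.
  - by rewrite divr_ge0// ltW.
  - by rewrite mulr_ge0// divr_ge0// ltW.
  move=> y /andP[cy yc].
  have fy : m <= f y by apply: f_ge; apply/andP; split; lra.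
  have := avg y; rewrite ler_norml => /andP[avg1 _].
  have : m / 2 <= n%:R^-1 * \sum_(t < n) gs t y by lra.
  by rewrite ler_pdivlMl.
have cntI : \sum_(t < n) Num.min 1 (p I t) - C3 * Num.sqrt (n%:R * ln n%:R) <=
    \sum_(t < n) \1_I (xs t).
  by have := counting n2 jn; rewrite sumrB -/s -/I; lra.
have kI : expR (- (2 / a)) * \sum_(t < n) \1_I (xs t) <=
    \sum_(t < n) nkernel (h n) x (xs t).
  rewrite mulr_sumr; apply: ler_sum => t _; rewrite indicE.
  have [/set_mem|_] := boolP (xs t \in I); last by rewrite mulr0 nkernel_ge0.
  rewrite /I /= in_itv/= mulr1 => /andP[x1 x2].
  apply: nkernel_near => //; first exact: ltW.
  by rewrite ler_norml -/s; apply/andP; split; lra.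
apply: le_trans kI; rewrite -mulrA ler_wpM2l ?expR_ge0//.
apply: le_trans cntI.
have q0 : 0 <= q n by rewrite mulr_ge0// ltW.
have errI : C3 * Num.sqrt (n%:R * ln n%:R) <= m / 8 * q n.
  apply: le_trans (_ : (`|C3| + 1) * (e * q n) <= _); last first.
    have -> : (`|C3| + 1) * (e * q n) = m / 8 * q n by rewrite /e; field; rewrite gt_eqF.
    by [].
  apply: (@le_trans _ _ (`|C3| * Num.sqrt (n%:R * ln n%:R))).
    by rewrite ler_wpM2r// ler_norm.
  by apply: ler_pM => //; rewrite lerDl.
have -> : m / 8 * q n = n%:R * (m / 2) * (s / 2) - m / 8 * q n by rewrite /q -/s; field.
by rewrite lerB.
Unshelve. all: by end_near. Qed.

Variables (us : nat -> R) (reg : R -> R) (E : nat -> R) (C0 C1 C2 : R) (n0 : nat).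
Hypothesis reg_bounded : forall y, 0 <= y -> `|reg y| <= C0.
Hypothesis reg_continuous : {within `[0, +oo[, continuous reg}.
Hypothesis us_growth : forall n, \sum_(t < n) `|us t| <= C1 * n%:R ^+ 2.
Hypothesis numerator : forall n j, (n0 <= n)%N -> (2 <= n)%N -> (j < n ^ 4)%N ->
  `|\sum_(t < n) (us t - reg (xs t)) * nkernel (h n) (c n j) (xs t)| <= C2 * E n.
Hypothesis E_rate : forall e, 0 < e -> \forall n \near \oo, E n <= e * q n.
Hypotheses (C10 : 0 <= C1) (C20 : 0 <= C2).

Let C00 : 0 <= C0.
Proof. exact: le_trans (normr_ge0 _) (reg_bounded (lexx 0)). Qed.

(* Passing from a grid point to [x] costs the Lipschitz constant of the kernel,
   of order [1 / h n <= n], times the mesh [n ^- 4]. *)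
Lemma numerator_le (e : R) : 0 < e -> \forall n \near \oo, forall x, a <= x <= b ->
  `|\sum_(t < n) (us t - reg (xs t)) * nkernel (h n) x (xs t)| <= e * q n.
Proof.
move=> e0.
pose L := 1 / a + 1 + ln (b / a).
have L0 : 0 <= L.
  rewrite !addr_ge0 ?divr_ge0 ?(ltW a_gt0)// ln_ge0//.
  by rewrite ler_pdivlMr// mul1r ltW.
(* Half of [e] for the value at the grid point, half for the passage to [x]; the added 1 keeps the
   divisors positive. *)
pose e1 := e / 2 / (C2 + 1); pose e2 := e / 2 / (L * (C1 + C0) + 1).
have e10 : 0 < e1 by rewrite !divr_gt0// ltr_wpDl.
have LC : 0 <= L * (C1 + C0) by rewrite mulr_ge0// addr_ge0.
have e20 : 0 < e2 by rewrite !divr_gt0// ltr_wpDl.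
near=> n => x xab.
have n2 : (2 <= n)%N by near: n; exact: nbhs_infty_ge.
have n0n : (n0 <= n)%N by near: n; exact: nbhs_infty_ge.
have n1 : 1 <= n%:R :> R by rewrite ler1n ltnW.
have nR0 : 0 < n%:R :> R by rewrite (lt_le_trans _ n1).
have q1 : 1 <= q n by near: n; exact: q_ge1.
have hn1 : h n < 1 by near: n; exact: bandwidth_lt.
have nh : 1 <= n%:R * h n by near: n; exact: nh1.
have rate : E n <= e1 * q n by near: n; exact: E_rate.
have ms : n%:R ^+ 3 * mesh n <= e2 by near: n; exact: mesh_le.
have [j jn cxc] := grid_near (ltnW n2) xab.
have /andP[cx xc] := cxc.
have /andP[ax xb] := xab.
have mesh0 : 0 <= mesh n by rewrite divr_ge0 ?exprn_ge0// subr_ge0 ltW.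
have ac : a <= c n j by rewrite lerDl mulr_ge0.
have cab : a <= c n j <= b by rewrite ac (le_trans cx).
have -> : \sum_(t < n) (us t - reg (xs t)) * nkernel (h n) x (xs t) =
    \sum_(t < n) (us t - reg (xs t)) * nkernel (h n) (c n j) (xs t) +
    \sum_(t < n) (us t - reg (xs t)) *
      (nkernel (h n) x (xs t) - nkernel (h n) (c n j) (xs t)).
  by rewrite -big_split; apply: eq_bigr => t _ /=; ring.
apply: le_trans (ler_normD _ _) _.
have first : `|\sum_(t < n) (us t - reg (xs t)) * nkernel (h n) (c n j) (xs t)| <=
    e / 2 * q n.
  apply: le_trans (numerator n0n n2 jn) _.
  apply: (@le_trans _ _ (C2 * (e1 * q n))); first by rewrite ler_wpM2l.
  have -> : C2 * (e1 * q n) = C2 / (C2 + 1) * (e / 2 * q n).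
    by rewrite /e1; field; rewrite gt_eqF// ltr_wpDl.
  rewrite ler_piMl//; first by rewrite mulr_ge0 ?divr_ge0 ?(ltW e0)// (le_trans _ q1).
  by rewrite ler_pdivrMr ?mul1r ?lerDl// ltr_wpDl.
(* Uses [1 <= n * h n] to bound [1 / h n] by [n], and [h n < 1] to replace [h n / a] by [1 / a] in
   [L]. *)
have lip t : `|nkernel (h n) x (xs t) - nkernel (h n) (c n j) (xs t)| <=
    n%:R * mesh n * L.
  apply: le_trans (nkernel_lipschitz a_gt0 (h_gt0 n) xab cab (xs_ge0 t)) _.
  apply: ler_pM.
  - by rewrite divr_ge0// ltW.
  - rewrite !addr_ge0 ?divr_ge0 ?(ltW a_gt0) ?(ltW (h_gt0 n))// ln_ge0//.
    by rewrite ler_pdivlMr// mul1r ltW.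
  - rewrite ler_pdivrMr// ger0_norm ?subr_ge0//.
    have -> : n%:R * mesh n * h n = n%:R * h n * mesh n by ring.
    apply: (@le_trans _ _ (mesh n)); first by rewrite lerBlDl.
    by rewrite ler_peMl.
  - by rewrite /L !lerD2r ler_wpM2r ?invr_ge0 ?ltW.
have sum_us : \sum_(t < n) `|us t - reg (xs t)| <= (C1 + C0) * n%:R ^+ 2.
  apply: (@le_trans _ _ (\sum_(t < n) (`|us t| + C0))).
    apply: ler_sum => t _; apply: le_trans (ler_normB _ _) _.
    by rewrite lerD2l reg_bounded.
  rewrite big_split/= mulrDl lerD ?us_growth//.
  rewrite sumr_const card_ord -[C0 *+ n]mulr_natr ler_wpM2l//.
  by rewrite -[leLHS]expr1 ler_weXn2l.
have second : `|\sum_(t < n) (us t - reg (xs t)) *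
      (nkernel (h n) x (xs t) - nkernel (h n) (c n j) (xs t))| <= e / 2 * q n.
  apply: le_trans (ler_norm_sum _ _ _) _.
  apply: (@le_trans _ _ (\sum_(t < n) `|us t - reg (xs t)| * (n%:R * mesh n * L))).
    by apply: ler_sum => t _; rewrite normrM ler_wpM2l.
  rewrite -mulr_suml.
  apply: (@le_trans _ _ ((C1 + C0) * n%:R ^+ 2 * (n%:R * mesh n * L))).
    by apply: ler_wpM2r => //; apply: mulr_ge0 => //; exact: mulr_ge0.
  have -> : (C1 + C0) * n%:R ^+ 2 * (n%:R * mesh n * L) =
    L * (C1 + C0) * (n%:R ^+ 3 * mesh n) by ring.
  apply: (@le_trans _ _ (L * (C1 + C0) * e2)); first by rewrite ler_wpM2l.
  apply: (@le_trans _ _ (e / 2)); last first.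
    by rewrite ler_peMr// divr_ge0// ltW.
  have -> : L * (C1 + C0) * e2 = L * (C1 + C0) / (L * (C1 + C0) + 1) * (e / 2).
    by rewrite /e2; field; rewrite gt_eqF// ltr_wpDl.
  rewrite ler_piMl//; first by rewrite divr_ge0// ltW.
  by rewrite ler_pdivrMr ?mul1r ?lerDl// ltr_wpDl.
lra.
Unshelve. all: by end_near. Qed.

(** Residuals, observations near [x] and observations far from [x] contribute at most [e / 3 * S]
    each, where [S] is the denominator; the first and the last use [c0 * q n <= S]. *)
Lemma estimator_cvg (e : R) : 0 < e -> \forall n \near \oo, forall x, a <= x <= b ->
  `|(\sum_(t < n) us t * nkernel (h n) x (xs t)) /
      (\sum_(t < n) nkernel (h n) x (xs t)) - reg x| <= e.
Proof.
move=> e0.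
have [c0 c00 denominator] := denominator_ge.
have e3 : 0 < e / 3 by rewrite divr_gt0.
have b0 : 0 < b by rewrite (lt_trans a_gt0).
have [delta' delta'0 Hdelta'] := 
  @uniform_continuity_segment R reg a b _ a_gt0 reg_continuous e3.
(* The far estimate on the kernel requires [delta <= b]. *)
pose delta := Num.min delta' b.
have delta_gt0 : 0 < delta by rewrite lt_min delta'0.
pose eta := (delta / b) ^+ 2 / 9.
have eta0 : 0 < eta by rewrite divr_gt0// exprn_gt0// divr_gt0.
(* The far terms add up to [2 * C0 * Num.sqrt (h n) / (a * eta) * q n]; a square root below [e4]
   makes this at most [c0 * (e / 3) * q n]. *)
pose e4 := c0 * (e / 3) * (a * eta) / (2 * C0 + 1).
have C01 : 0 < 2 * C0 + 1 by rewrite ltr_wpDl// mulr_ge0.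
have e40 : 0 < e4 by rewrite divr_gt0// mulr_gt0// mulr_gt0.
have num := numerator_le (mulr_gt0 c00 e3).
near=> n => x xab.
have /andP[ax xb] := xab.
have q1 : 1 <= q n by near: n; exact: q_ge1.
have den : c0 * q n <= \sum_(t < n) nkernel (h n) x (xs t).
  by move: (x) xab; near: n; exact: denominator.
have numx : `|\sum_(t < n) (us t - reg (xs t)) * nkernel (h n) x (xs t)| <=
   c0 * (e / 3) * q n.
  by move: (x) xab; near: n; exact: num.
have sh : Num.sqrt (h n) < e4 by near: n; exact: sqrt_bandwidth_lt.
set S := \sum_(t < n) nkernel (h n) x (xs t) in den *.
have cq0 : 0 < c0 * q n by rewrite mulr_gt0// (lt_le_trans _ q1).
have S0 : 0 < S by rewrite (lt_le_trans cq0).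
have far t : `|(reg (xs t) - reg x) * nkernel (h n) x (xs t)| <=
    e / 3 * nkernel (h n) x (xs t) + 2 * C0 * (h n / (a * eta)).
  have k0 := nkernel_ge0 (h n) x (xs t).
  have h0 := h_gt0 n.
  have hae : 0 <= h n / (a * eta) by rewrite ltW// divr_gt0// mulr_gt0.
  rewrite normrM (ger0_norm k0).
  have [xd|dx] := ltP `|xs t - x| delta.
    apply: (@le_trans _ _ (e / 3 * nkernel (h n) x (xs t))).
      rewrite ler_wpM2r// Hdelta'//.
      by apply: lt_le_trans xd _; rewrite ge_min lexx.
    by rewrite lerDl mulr_ge0// ?mulr_ge0// hae.
  apply: (@le_trans _ _ (2 * C0 * (h n / (a * eta)))); last first.
    by rewrite lerDr mulr_ge0// ltW.
  apply: ler_pM => //.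
    apply: le_trans (ler_normB _ _) _.
    have := reg_bounded (xs_ge0 t); have := reg_bounded (ltW (lt_le_trans a_gt0 ax)); lra.
  apply: le_trans (nkernel_far a_gt0 ax xb h0 _ (xs_ge0 t) dx) _.
    by rewrite (ltW delta_gt0)/= ge_min lexx orbT.
  (* The crude bound [expR (- z) <= z^-1] with [z = a * eta / h n] is enough: it leaves a factor
     [h n], the square of [Num.sqrt (h n)]. *)
  rewrite -/eta expRN -[leRHS]invrK lef_pV2 ?posrE ?expR_gt0//; last first.
    by rewrite invr_gt0 divr_gt0// mulr_gt0.
  rewrite invf_div; apply: le_trans (expR_ge1Dx _).
  have -> : a * eta / h n = a / h n * eta by ring.
  by rewrite lerDr.
have -> : (\sum_(t < n) us t * nkernel (h n) x (xs t)) / S - reg x =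
  (\sum_(t < n) (us t - reg (xs t)) * nkernel (h n) x (xs t) +
   \sum_(t < n) (reg (xs t) - reg x) * nkernel (h n) x (xs t)) / S.
  rewrite -big_split/=.
  have -> : reg x = (\sum_(t < n) reg x * nkernel (h n) x (xs t)) / S.
    by rewrite -mulr_sumr -/S mulfK// gt_eqF.
  rewrite -mulrBl -sumrB; congr (_ / _); apply: eq_bigr => t _.
  rewrite -mulr_sumr -/S mulfK ?gt_eqF//; ring.
rewrite normf_div (gtr0_norm S0) ler_pdivrMr//.
apply: le_trans (ler_normD _ _) _.
have sum2 : `|\sum_(t < n) (reg (xs t) - reg x) * nkernel (h n) x (xs t)| <=
    e / 3 * S + c0 * (e / 3) * q n.
  apply: le_trans (ler_norm_sum _ _ _) _.
  apply: (@le_trans _ _ (\sum_(t < n)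
      (e / 3 * nkernel (h n) x (xs t) + 2 * C0 * (h n / (a * eta))))).
    by apply: ler_sum => t _; exact: far.
  rewrite big_split/= -mulr_sumr lerD2l sumr_const card_ord -[_ *+ n]mulr_natl.
  have ae0 : 0 < a * eta by rewrite mulr_gt0.
  rewrite -(sqr_sqrtr (ltW (h_gt0 n))) expr2.
  have -> : n%:R * (2 * C0 * (Num.sqrt (h n) * Num.sqrt (h n) / (a * eta))) =
    2 * C0 * Num.sqrt (h n) / (a * eta) * q n.
    by rewrite /q; field; rewrite ?gt_eqF.
  rewrite ler_wpM2r//; first by rewrite (le_trans _ q1).
  rewrite ler_pdivrMr//.
  apply: (@le_trans _ _ ((2 * C0 + 1) * e4)).
    by apply: ler_pM; rewrite ?mulr_ge0 ?lerDl// ltW.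
  by rewrite /e4 mulrC divfK// gt_eqF.
have : c0 * (e / 3) * q n <= e / 3 * S.
  by have := ler_wpM2l (ltW e3) den; lra.
lra.
Unshelve. all: by end_near. Qed.

End pathwise.

(** * The process and its past *)

Section process_filtrations.
Context d (T : measurableType d) (R : realType) (P : probability T R).
Variables X Y : int -> T -> R.
Hypotheses (mX : forall t, measurable_fun setT (X t))
  (mY : forall t, measurable_fun setT (Y t)).

Lemma past_sigma_algebra t : sigma_algebra setT (past X Y t).
Proof. exact: smallest_sigma_algebra. Qed.

Lemma past_next_sigma_algebra t : sigma_algebra setT (past_next X Y t).
Proof. exact: smallest_sigma_algebra. Qed.

Lemma past_sub_measurable t : past X Y t `<=` measurable.
Proof.
apply: smallest_sub; first exact: sigma_algebra_measurable.
move=> B [s _ [C mC <-]]; rewrite -[X in measurable X]setTI.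
have mXY : measurable_fun setT (fun w => (X s w, Y s w)).
  exact: measurable_fun_pair.
by rewrite setTI; exact: mXY.
Qed.

Lemma past_next_sub_measurable t : past_next X Y t `<=` measurable.
Proof.
apply: smallest_sub; first exact: sigma_algebra_measurable.
move=> B [[C mC <-]|[s _ [C mC <-]]].
  exact: mX.
have mXY : measurable_fun setT (fun w => (X s w, Y s w)).
  exact: measurable_fun_pair.
exact: mXY.
Qed.

Lemma past_le s t : s <= t -> past X Y s `<=` past X Y t.
Proof.
move=> st; apply: sub_sigma_algebra2 => B [r /= rs BXY].
by exists r => //=; exact: le_trans st.
Qed.

Lemma measurable_pair_past s t : s <= t ->
  measurable_fun setT ((fun w => (X s w, Y s w)) : g_sigma_algebraType (past X Y t) -> R * R).
Proof.
move=> st; apply: measurable_fun_generated => B HB.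
by apply: sub_sigma_algebra; exists s.
Qed.

Lemma measurable_pair_past_next s t : s <= t ->
  measurable_fun setT ((fun w => (X s w, Y s w)) : g_sigma_algebraType (past_next X Y t) -> R * R).
Proof.
move=> st; apply: measurable_fun_generated => B HB.
by apply: sub_sigma_algebra; right; exists s.
Qed.

Lemma measurable_next t :
  measurable_fun setT (X (t + 1) : g_sigma_algebraType (past_next X Y t) -> R).
Proof.
apply: measurable_fun_generated => B HB.
by apply: sub_sigma_algebra; left.
Qed.

Lemma measurable_fst_past_next s t : s <= t + 1 ->
  measurable_fun setT (X s : g_sigma_algebraType (past_next X Y t) -> R).
Proof.
move=> st1; have [->|ne] := eqVneq s (t + 1); first exact: measurable_next.
have st : s <= t by move: st1 ne; lia.
exact: (measurableT_comp measurable_fst (measurable_pair_past_next st)).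
Qed.

Lemma measurable_snd_past_next s t : s <= t ->
  measurable_fun setT (Y s : g_sigma_algebraType (past_next X Y t) -> R).
Proof.
by move=> st; exact: (measurableT_comp measurable_snd (measurable_pair_past_next st)).
Qed.

Lemma measurable_fst_past s t : s <= t ->
  measurable_fun setT (X s : g_sigma_algebraType (past X Y t) -> R).
Proof.
by move=> st; exact: (measurableT_comp measurable_fst (measurable_pair_past st)).
Qed.

Lemma past_next_le s t : s <= t -> past_next X Y s `<=` past_next X Y t.
Proof.
move=> st; apply: smallest_sub; first exact: past_next_sigma_algebra.
move=> B [[C mC <-]|[r /= rs HB]].
  have := @measurable_fst_past_next (s + 1) t _ measurableT C mC.
  by rewrite measurable_subE; [apply; rewrite lerD2r|exact: past_next_sigma_algebra].
by apply: sub_sigma_algebra; right; exists r => //=; exact: le_trans st.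
Qed.

(** Stationarity with shift [t - 1], applied to cylinders on the second coordinate at time 1, shows
    that [Y t] and [Y 1] have the same law. *)
Lemma stationary_integral (psi : R -> R) t :
  strictly_stationary P (fun t w => (X t w, Y t w)) ->
  measurable_fun setT psi -> (forall y, 0 <= psi y) ->
  (\int[P]_w (psi (Y t w))%:E = \int[P]_w (psi (Y 1 w))%:E)%E.
Proof.
move=> stat mpsi psi0.
pose m1 s : {measure set (measurableTypeR R) -> \bar R} :=
  pushforward P (Y s : T -> measurableTypeR R).
have intE s : (\int[P]_w (psi (Y s w))%:E = \int[m1 mY s]_y (psi y)%:E)%E.
  rewrite ge0_integral_pushforward//.
  - exact: mY.
  - exact/measurable_EFinP.
  - by move=> y _; rewrite lee_fin.
rewrite !intE; apply: eq_measure_integral => A mA _.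
rewrite /m1 /= /pushforward.
have := stat (t - 1) [set v | A (v 1).2].
rewrite /=; have -> : (1 + (t - 1)) = t by lia.
apply; apply: sub_sigma_algebra; exists 1 => //.
exists (snd @^-1` A); last by rewrite setTI.
by rewrite -[X in measurable X]setTI; exact: measurable_snd.
Qed.

End process_filtrations.

Lemma measurable_comp_ge0 d (T : measurableType d) (R : realType) (g : R -> R) (Z : T -> R) :
  measurable_fun (`[0, +oo[ : set R) g -> measurable_fun setT Z -> (forall w, 0 <= Z w) ->
  measurable_fun setT (fun w => g (Z w)).
Proof.
move=> mg mZ Z0; apply: (measurable_comp (measurable_itv `[0, +oo[) _ mg mZ).
by move=> _ [w _ <-]; rewrite /= in_itv/= Z0.
Qed.

(** Nonemptiness makes the supremum nonnegative; over the empty set it would be [-oo]. *)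
Lemma cvg_sup_abs0P (R : realType) (D : set R) (g : nat -> R -> R) : D !=set0 ->
  sup_abs D (g n) @[n --> \oo] --> 0%E <->
  (forall e, 0 < e -> \forall n \near \oo, forall x, D x -> `|g n x| <= e).
Proof.
move=> [x0 Dx0].
have s0 n : (0 <= sup_abs D (g n))%E.
  by apply: le_trans (ereal_sup_ubound _); [|by exists x0]; rewrite lee_fin.
split=> [cg e e0|H].
- move/fine_cvgP : cg => [gfin /cvgr0Pnorm_lt/(_ e e0)]; apply: filterS2 gfin => n gfin gn x Dx.
  rewrite ger0_norm ?fine_ge0// in gn.
  rewrite -lee_fin; apply: le_trans (_ : (sup_abs D (g n) <= _)%E).
    by apply: ereal_sup_ubound; exists x.
  by rewrite -(fineK gfin) lee_fin ltW.
- apply/fine_cvgP; split.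
    have := H 1 ltr01; apply: filterS => n Hn.
    rewrite ge0_fin_numE//; apply: le_lt_trans (ltry 1).
    by apply: ge_ereal_sup => _ [x Dx <-]; rewrite lee_fin Hn.
  apply/cvgr0Pnorm_le => e e0; have := H e e0; apply: filterS => n Hn /=.
  have se : (sup_abs D (g n) <= e%:E)%E.
    by apply: ge_ereal_sup => _ [x Dx <-]; rewrite lee_fin Hn.
  have sf : sup_abs D (g n) \is a fin_num.
    by rewrite ge0_fin_numE// (le_lt_trans se)// ltry.
  by rewrite ger0_norm ?fine_ge0// -lee_fin fineK.
Qed.

Lemma lez_succB1 (s t : nat) : (s <= t)%N -> (s.+1)%:Z - 1 <= (t.+1)%:Z - 1.
Proof. lia. Qed.

Lemma lez_succB1K (s t : nat) : (s <= t)%N -> (s.+1)%:Z <= (t.+1)%:Z - 1 + 1.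
Proof. lia. Qed.

Lemma ltz_succB1 (s t : nat) : (s < t)%N -> (s.+1)%:Z <= (t.+1)%:Z - 1.
Proof. lia. Qed.

(** * Uniform almost sure convergence of the estimator *)

Theorem theorem3p2 (d : measure_display) (T : measurableType d) (R : realType)
  (P : probability T R)
  (X Y : int -> {RV P >-> R})
  (X_ge0 : forall t w, 0 <= X t w)
  (Y_ge0 : forall t w, 0 <= Y t w)
  (stationary_XY : strictly_stationary P (fun t w => (X t w, Y t w)))
  (ergodic_XY : ergodic P (fun t w => (X t w, Y t w)))
  (f : R -> R)
  (density_X : forall t, is_density (X t) f)
  (abs_cont_Y : forall t, distribution P (Y t) `<< lebesgue_measure)
  (Phi : R -> R)
  (measurable_Phi : measurable_fun (`[0, +oo[ : set R) Phi)
  (integrable_Phi : ('E_P[fun w => (`|Phi (Y 1%:Z w)|)%R] < +oo)%E)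
  (reg : R -> R)
  (regression_reg : is_regression P (fun w => Phi (Y 1%:Z w)) (X 1%:Z) reg)
  (h : nat -> R)
  (h_gt0 : forall n, 0 < h n)
  (h_cvg0 : h n @[n --> \oo] --> (0 : R))
  (a b : R) (a_gt0 : 0 < a) (a_lt_b : a < b)
  (fcond : int -> T -> R -> R)
  (H1_density : forall t : int,
    is_cond_density P (past X Y (t - 1)) (X t) (fcond t))
  (H1_C0 : forall t : int, {ae P, forall w, C0 (fcond t w)})
  (H1_f : C0 f)
  (H2 : {ae P, forall w,
    sup_abs setT
      (fun x => n%:R^-1 * (\sum_(1 <= t < n.+1) fcond t%:Z w x) - f x)
    @[n --> \oo] --> 0%E})
  (H3_continuous : {within `[0, +oo[, continuous reg})
  (H3_bounded : [bounded reg x | x in `[0, +oo[])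
  (H4 : forall t : int,
    is_cond_exp P (past_next X Y (t - 1))
      (fun w => (Phi (Y t w))%:E) (fun w => (reg (X t w))%:E) /\
    is_cond_exp P (preimage_set_system setT (X t) measurable)
      (fun w => (Phi (Y t w))%:E) (fun w => (reg (X t w))%:E))
  (tau : R) (tau_gt0 : 0 < tau)
  (H5 : ('E_P[fun w => (`|Phi (Y 1%:Z w)| `^ (tau + 1))%R] < +oo)%E)
  (H6 : 0 < inf [set f x | x in `[a, b]])
  (H7_nondecreasing : nondecreasing_seq (fun n => n%:R * Num.sqrt (h n)))
  (H7_pinfty : n%:R * Num.sqrt (h n) @[n --> \oo] --> +oo)
  (H7_theta : exists theta : R, 0 < theta < tau / (tau + 1) /\
    n%:R `^ theta * h n / ln n%:R @[n --> \oo] --> +oo) :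
  {ae P, forall w,
    sup_abs `[a, b]
      (fun x => gamma_regression_estimator h Phi X Y n w x - reg x)
    @[n --> \oo] --> 0%E}.
Proof.
have mX t : measurable_fun setT (X t : T -> R) by [].
have mY t : measurable_fun setT (Y t : T -> R) by [].
have a_le_b := ltW a_lt_b.
have [theta [theta_itv h_rate]] := H7_theta.
have theta1 := theta_lt1 tau_gt0 theta_itv.
have nh1 := rate_nh h_gt0 tau_gt0 theta_itv h_rate.
have [C0 regC0] : exists C0, forall y, 0 <= y -> `|reg y| <= C0.
  have [M [_ HM]] := H3_bounded; exists (M + 1) => y y0.
  by apply: (HM (M + 1)); rewrite ?ltrDl//= in_itv/= y0.
have C00 : 0 <= C0 := le_trans (normr_ge0 _) (regC0 0 (lexx 0)).
have [mreg _] := regression_reg.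
(* Two filtrations, both for time [t + 1]: in the residuals the kernel weight at [X] must be known,
   which [F] provides; in the counts [X] itself is the innovation, hence the smaller [G]. *)
pose F t := past_next X Y ((t.+1)%:Z - 1).
pose G t := past X Y ((t.+1)%:Z - 1).
have sF t : sigma_algebra setT (F t) by exact: past_next_sigma_algebra.
have sG t : sigma_algebra setT (G t) by exact: past_sigma_algebra.
have subF t : F t `<=` measurable by exact: past_next_sub_measurable.
have subG t : G t `<=` measurable by exact: past_sub_measurable.
have ndF s t : (s <= t)%N -> F s `<=` F t by move=> st; apply: past_next_le; exact: lez_succB1.
have ndG s t : (s <= t)%N -> G s `<=` G t by move=> st; apply: past_le; exact: lez_succB1.
pose x t w : R := X (t.+1)%:Z w.
pose u t w : R := Phi (Y (t.+1)%:Z w).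
pose r t w : R := reg (X (t.+1)%:Z w).
pose g t w : R -> R := fcond (t.+1)%:Z w.
have mx s t : (s <= t)%N -> measurable_fun setT (x s : g_sigma_algebraType (F t) -> R).
  by move=> st; apply: measurable_fst_past_next; exact: lez_succB1K.
have mr s t : (s <= t)%N -> measurable_fun setT (r s : g_sigma_algebraType (F t) -> R).
  move=> st; apply: (measurable_comp_ge0 mreg (mx s t st)) => w; exact: X_ge0.
have mu s t : (s < t)%N -> measurable_fun setT (u s : g_sigma_algebraType (F t) -> R).
  move=> st; apply: (@measurable_comp_ge0 _ (g_sigma_algebraType (F t)) _ _ _ measurable_Phi).
    by apply: measurable_snd_past_next; exact: ltz_succB1.
  by move=> w; exact: Y_ge0.
have mxG s t : (s < t)%N -> measurable_fun setT (x s : g_sigma_algebraType (G t) -> R).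
  by move=> st; apply: measurable_fst_past; exact: ltz_succB1.
(* [Phi] is measurable on the half-line only; its extension by 0 agrees with it along the
   nonnegative [Y]. *)
pose Phi0 := Phi \_ `[0, +oo[.
have mPhi0 : measurable_fun setT Phi0 by apply/(measurable_restrictT _ _).1.
have uE t w : u t w = Phi0 (Y (t.+1)%:Z w).
  by rewrite /Phi0 patchE mem_set//= in_itv/= Y_ge0.
have moment (psi : R -> R) : measurable_fun setT psi -> (forall y, 0 <= psi y) ->
    (\int[P]_w (psi (u 0%N w))%:E < +oo)%E ->
    exists A, forall t, (\int[P]_w (psi (u t w))%:E <= A%:E)%E.
  move=> mpsi psi0 fin0.
  exists (fine (\int[P]_w (psi (u 0%N w))%:E)) => t.
  rewrite fineK; last first.
    by rewrite ge0_fin_numE//; apply: integral_ge0 => w _; rewrite lee_fin.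
  under eq_integral do rewrite uE.
  under [leRHS]eq_integral do rewrite uE.
  rewrite (@stationary_integral _ _ _ P _ _ mY (psi \o Phi0) _ stationary_XY)//.
    exact: measurableT_comp.
  by move=> y; exact: psi0.
have [A1 HA1] : exists A, forall t, (\int[P]_w (`|u t w|%R)%:E <= A%:E)%E.
  by apply: (moment (fun y => `|y|)) => //; move: integrable_Phi; rewrite unlock.
have [A2 HA2] : exists A, forall t, (\int[P]_w (`|u t w| `^ (tau + 1))%:E <= A%:E)%E.
  apply: (moment (fun y => `|y| `^ (tau + 1))).
  - exact: (@measurableT_comp _ _ _ _ _ _ (fun y : R => y `^ (tau + 1))).
  - by move=> y; exact: powR_ge0.
  - by move: H5; rewrite unlock.
have muT t : measurable_fun setT (u t).
  exact: (measurable_fun_sub (sF t.+1) (@subF t.+1) (mu t t.+1 (ltnSn t))).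
have growth_u : {ae P, forall w, exists C, 0 <= C /\
     forall n, \sum_(i < n) `|u i w| <= C * n%:R `^ (1 + 1)}.
  apply: (ae_partial_sums_growth (Z := fun i w => `|u i w|) ltr01 _ _ HA1) => // i.
  exact: measurableT_comp.
pose gam : R := (1 - theta) / 2.
pose eps : R := (tau * (1 - theta) - theta) / 2.
have eps0 : 0 < eps.
  case/andP: theta_itv => _; rewrite ltr_pdivlMr ?addr_gt0// => H.
  by rewrite divr_gt0// subr_gt0; lra.
have gam0 : 0 < gam by rewrite divr_gt0// subr_gt0.
pose M n : R := n%:R `^ gam.
(* [C0 <= M n] serves the truncation; [1 <= M n] deduces the counting rate from the deviation
   rate. *)
have [n0 [HC0 HM1]] : exists n0, (forall n, (n0 <= n)%N -> C0 <= M n) /\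
    (forall n, (n0 <= n)%N -> 1 <= M n).
  have : \forall n \near \oo, C0 + 1 <= M n.
    near=> n; rewrite -[leLHS]powRr1 ?addr_ge0// -(mulVf (lt0r_neq0 gam0)) powRrM.
    rewrite ge0_ler_powR ?nnegrE ?powR_ge0 ?(ltW gam0)//.
    by near: n; exact: nbhs_infty_ger.
  by case=> n0 _ Hn0; exists n0; split => n n0n; have := Hn0 n n0n => /=; lra.
have M0 n : (n0 <= n)%N -> 0 < M n by move=> /HM1; lra.
have num := @ae_numerator_grid _ _ _ P F sF subF ndF x u r mx mr mu
  (fun t w => X_ge0 _ w) C0 tau A2 (fun t w => regC0 _ (X_ge0 _ w))
  _ tau_gt0 HA2 M h a b eps n0 HC0 M0 h_gt0 a_gt0 a_lt_b eps0.
have {}num := num (fun t => (H4 (t.+1)%:Z).1).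
have mass := @ae_cond_density_mass _ _ _ P G sG subG x g (fun t => H1_density (t.+1)%:Z).
pose c (n j : nat) : R := a + j%:R * ((b - a) / n%:R ^+ 4).
have cnt := @ae_counting _ _ _ P G sG subG ndG x g mxG (fun t => H1_density (t.+1)%:Z)
  (fun n j => `[c n j, c n j + Num.sqrt (h n) / 2]%classic)
  (fun n j => measurable_itv _).
have f_ge0 y : 0 <= f y by case: (density_X 0) => /(_ y).
pose mf := inf [set f y | y in `[a, b]].
have f_inf y : a <= y <= b -> mf <= f y.
  move=> yab; apply: ge_inf; last by exists y => //=; rewrite in_itv.
  by exists 0 => _ [z _ <-].
(* Counting intervals start in [[a, b]] but may end beyond [b]; continuity of [f] at [b] extends a
   lower bound there, at the price of halving it. *)
have [delta0 delta00 f_lb] : exists2 delta0, 0 < delta0 &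
    forall y, a <= y <= b + delta0 -> mf / 2 <= f y.
  have mf2 : 0 < mf / 2 by rewrite divr_gt0.
  have [cf _ _] := H1_f.
  have /cvgrPdist_lt/(_ _ mf2) /nbhs_ballP[rho /= rho0 Hrho] := cf b.
  exists (rho / 2); first by rewrite divr_gt0.
  move=> y /andP[ay yb]; have [yb'|by'] := leP y b.
    by have := f_inf y; rewrite ay yb' => /(_ isT); lra.
  have : `|f b - f y| < mf / 2.
    by apply: Hrho; rewrite /ball/= distrC gtr0_norm ?subr_gt0//; lra.
  have := f_inf b; rewrite a_le_b lexx => /(_ isT) fb.
  by rewrite ltr_norml => /andP[]; lra.
near=> w.
have avg : sup_abs setT
    (fun x => n%:R^-1 * (\sum_(1 <= t < n.+1) fcond t%:Z w x) - f x)
    @[n --> \oo] --> 0%E by near: w; exact: H2.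
have gmass : forall t, (\int[lebesgue_measure]_y (g t w y)%:E = 1)%E.
  by near: w; exact: mass.
have [C1 [C10 HC1]] : exists C, 0 <= C /\
     forall n, \sum_(i < n) `|u i w| <= C * n%:R `^ (1 + 1).
  by near: w; exact: growth_u.
have [C2 [C20 HC2]] : exists C, 0 <= C /\
    forall n j, (n0 <= n)%N -> (2 <= n)%N -> (j < n ^ 4)%N ->
    `|\sum_(t < n) (u t w - r t w) *
       nkernel (h n) (a + j%:R * ((b - a) / n%:R ^+ 4)) (x t w)| <=
    C * (M n * Num.sqrt (n%:R * ln n%:R) + M n `^ (- tau) * n%:R `^ (1 + eps)).
  by near: w; exact: num.
have [C3 HC3] : exists C, forall n j, (2 <= n)%N -> (j < n ^ 4)%N ->
    \sum_(t < n) (Num.min 1 (fine (\int[lebesgue_measure]_(y in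
         `[c n j, c n j + Num.sqrt (h n) / 2]) (g t w y)%:E)) -
       \1_`[c n j, c n j + Num.sqrt (h n) / 2] (x t w)) <=
    C * Num.sqrt (n%:R * ln n%:R).
  by near: w; exact: cnt.
have mg t : measurable_fun setT (g t w).
  have [_ mfc _] := H1_density (t.+1)%:Z.
  exact: (measurableT_comp mfc (pair1_measurable (w : g_sigma_algebraType (G t)))).
have g0 t y : 0 <= g t w y by have [g0 _ _] := H1_density (t.+1)%:Z; exact: g0.
have favg e : 0 < e -> \forall n \near \oo, forall y,
    `|n%:R^-1 * (\sum_(t < n) g t w y) - f y| <= e.
  move=> e0; have setT0 : [set: R] !=set0 by exists 0.
  have := (cvg_sup_abs0P _ setT0).1 avg e e0.
  apply: filterS => n Hn y; have := Hn y Logic.I.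
  by rewrite big_add1 big_mkord.
have cnt_rate e : 0 < e -> \forall n \near \oo,
    Num.sqrt (n%:R * ln n%:R) <= e * (n%:R * Num.sqrt (h n)).
  move=> e0; have := rate_deviation h_gt0 h_rate e0.
  apply: filterS2 (nbhs_infty_ge n0) => n /= n0n; apply: le_trans.
  by rewrite ler_peMl// HM1.
pose E n := M n * Num.sqrt (n%:R * ln n%:R) + M n `^ (- tau) * n%:R `^ (1 + eps).
have E_rate e : 0 < e -> \forall n \near \oo, E n <= e * (n%:R * Num.sqrt (h n)).
  move=> e0; have e20 : 0 < e / 2 by rewrite divr_gt0.
  have := rate_deviation h_gt0 h_rate e20; have := rate_tail tau h_gt0 h_rate e20.
  apply: filterS2 => n tail_le dev_le; rewrite /E.
  have := lerD dev_le tail_le; rewrite -mulrDl -splitr; exact.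
have us_growth n : \sum_(t < n) `|u t w| <= C1 * n%:R ^+ 2.
  by rewrite -powR_mulrn//; exact: HC1.
have main := @estimator_cvg R h a b h_gt0 h_cvg0 nh1 a_gt0 a_lt_b (x^~ w) (g^~ w) f
  C3 (mf / 2) delta0 (fun t => X_ge0 _ w) mg g0 gmass favg _ delta00 f_lb HC3 cnt_rate
  (u^~ w) reg E C0 C1 C2 n0 regC0 H3_continuous us_growth HC2 E_rate C10 C20.
have ab0 : [set` `[a, b]] !=set0 by exists a; rewrite /= in_itv/= lexx.
apply/(cvg_sup_abs0P _ ab0) => e e0.
have mf2 : 0 < mf / 2 by rewrite divr_gt0.
have := main mf2 e e0; apply: filterS => n Hn y /=; rewrite in_itv/= => yab.
rewrite gamma_regression_estimatorE//; first exact: Hn.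
by case/andP: yab => + _; exact: lt_le_trans.
Unshelve. all: by end_near. Qed.
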